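(* Let $y\in\mathcal{T}$ with $v_p(y)=-k$, $k\in\mathbb{Z}$. For $\mu$-almost all $\alpha\in p\mathbb{Z}_p$, the frequency of repetition of $y$ in the odd positions of the continued fraction expansion $[0,a_1,a_2,\dots]$ of $\alpha$ produced by the alternating $s$/$t$ algorithm, i.e. $\lim_{n\to\infty}\frac1n\#\{0\le i<n:\ a_{2i+1}=y\}$, exists, is the same for almost all $\alpha$ (independent of $\alpha$), and is equal to $p^{-2k+1}$.
   Context: $p$ is an odd prime, $v_p$ the $p$-adic valuation, $\mu$ the Haar measure on $\mathbb{Q}_p$ normalized by $\mu(p\mathbb{Z}_p)=1$. For $\alpha=\sum_{n\ge -r}c_np^n\in\mathbb{Q}_p$ with $c_n\in\{-\frac{p-1}2,\dots,\frac{p-1}2\}$, put $s(\alpha)=\sum_{n=-r}^{0}c_np^n$ (equal to $0$ if $r<0$) and $t(\alpha)=\sum_{n=-r}^{-1}c_np^n$ (equal to $0$ if $r\le0$). $\mathcal{T}=\mathbb{Z}[\frac1p]\cap(-\frac12,\frac12)$ is the set of values of $t$. The alternating $s$/$t$ algorithm computes, from $\alpha_0=\alpha$, for $n\ge0$: $a_n=s(\alpha_n)$ if $n$ is even, $a_n=t(\alpha_n)$ if $n$ is odd, and $\alpha_{n+1}=\frac1{\alpha_n-a_n}$, stopping if $\alpha_n=a_n$. For $\alpha\in p\mathbb{Z}_p$ one has $a_0=0$. *)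

(* Defs.v *)
From HB Require Import structures.
From mathcomp Require Import all_boot all_order all_algebra.
From mathcomp Require Import all_classical all_reals all_analysis.

Set Implicit Arguments.
Unset Strict Implicit.
Unset Printing Implicit Defensive.

Import Order.TTheory GRing.Theory Num.Theory.

Local Open Scope classical_set_scope.
Local Open Scope ring_scope.

(* Z_p as the inverse limit of the rings Z/p^n, the class mod p^n being
   represented by its residue in [0, p^n); the field [padic_resP] gives both
   the bound and the compatibility. *)
Record padic_int (p : nat) (p_pr : prime p) := PadicInt {
  padic_res :> nat -> nat;
  padic_resP : forall n, (padic_res n.+1 %% p ^ n)%N = padic_res n
}.

Section PadicInt.
Variables (p : nat) (p_pr : prime p).
Local Notation Zp := (padic_int p_pr).
Implicit Types x y z : Zp.

HB.instance Definition _ := gen_eqMixin Zp.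
HB.instance Definition _ := gen_choiceMixin Zp.

Lemma padic_intP x y : x =1 y -> x = y.
Proof.
case: x y => [f fP] [g gP] /= /funext fg; subst g.
by congr PadicInt; exact: Prop_irrelevance.
Qed.

Lemma padic_res_mod x n : (x n %% p ^ n)%N = x n.
Proof. by rewrite -{1}(padic_resP x n) modn_mod padic_resP. Qed.

Lemma padic_res_modD x n m : (x (n + m) %% p ^ n)%N = x n.
Proof.
elim: m => [|m IH]; first by rewrite addn0 padic_res_mod.
by rewrite -IH addnS -[in RHS](padic_resP x (n + m)) modn_dvdm ?dvdn_exp2l ?leq_addr.
Qed.

Definition padic_mk_proof (f : nat -> nat) :=
  forall n, f n.+1 = f n %[mod p ^ n].

Lemma padic_mk_subproof (f : nat -> nat) : padic_mk_proof f ->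
  forall n, ((f n.+1 %% p ^ n.+1) %% p ^ n)%N = (f n %% p ^ n)%N.
Proof. by move=> fP n; rewrite modn_dvdm ?dvdn_exp2l ?leqnSn. Qed.

Definition padic_mk (f : nat -> nat) (fP : padic_mk_proof f) : Zp :=
  PadicInt p_pr (padic_mk_subproof fP).

Lemma padic_nat_subproof (k : nat) : padic_mk_proof (fun=> k).
Proof. by []. Qed.
Definition padic_nat k : Zp := padic_mk (padic_nat_subproof k).

Lemma padic_add_subproof x y : padic_mk_proof (fun n => (x n + y n)%N).
Proof. by move=> n; rewrite -modnDm !padic_resP. Qed.
Definition padic_add x y : Zp := padic_mk (padic_add_subproof x y).

Lemma padic_mul_subproof x y : padic_mk_proof (fun n => (x n * y n)%N).
Proof. by move=> n; rewrite -modnMm !padic_resP. Qed.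
Definition padic_mul x y : Zp := padic_mk (padic_mul_subproof x y).

(* (p^n - 1) x is congruent to - x modulo p^n *)
Lemma padic_opp_subproof x : padic_mk_proof (fun n => ((p ^ n).-1 * x n)%N).
Proof.
move=> n; apply/eqP; rewrite -(eqn_modDr (x n)) -mulSnr prednK ?expn_gt0 ?prime_gt0 //.
rewrite modnMr -(modnDmr _ (x n)) -(padic_resP x n) modn_mod modnDmr -mulSnr.
by rewrite prednK ?expn_gt0 ?prime_gt0 // expnS -mulnA mulnCA modnMr.
Qed.
Definition padic_opp x : Zp := padic_mk (padic_opp_subproof x).

Lemma padic_addA : associative padic_add.
Proof.
by move=> x y z; apply: padic_intP => n /=; rewrite modnDml modnDmr addnA.
Qed.

Lemma padic_addC : commutative padic_add.
Proof. by move=> x y; apply: padic_intP => n /=; rewrite addnC. Qed.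

Lemma padic_add0 : left_id (padic_nat 0) padic_add.
Proof. by move=> x; apply: padic_intP => n /=; rewrite mod0n padic_res_mod. Qed.

Lemma padic_addN : left_inverse (padic_nat 0) padic_opp padic_add.
Proof.
move=> x; apply: padic_intP => n /=.
by rewrite modnDml -mulSnr prednK ?expn_gt0 ?prime_gt0 // modnMr mod0n.
Qed.

HB.instance Definition _ := GRing.isZmodule.Build Zp
  padic_addA padic_addC padic_add0 padic_addN.

Lemma padic_mulA : associative padic_mul.
Proof.
by move=> x y z; apply: padic_intP => n /=; rewrite modnMml modnMmr mulnA.
Qed.

Lemma padic_mulC : commutative padic_mul.
Proof. by move=> x y; apply: padic_intP => n /=; rewrite mulnC. Qed.

Lemma padic_mul1 : left_id (padic_nat 1) padic_mul.
Proof.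
by move=> x; apply: padic_intP => n /=; rewrite modnMml mul1n padic_res_mod.
Qed.

Lemma padic_mulDl : left_distributive padic_mul padic_add.
Proof.
move=> x y z; apply: padic_intP => n /=.
by rewrite modnMml modnDml modnDmr mulnDl.
Qed.

Lemma padic_1neq0 : padic_nat 1 != padic_nat 0.
Proof.
apply/eqP => /(congr1 (fun x : Zp => x 1%N)) /=.
by rewrite expn1 mod0n modn_small // prime_gt1.
Qed.

HB.instance Definition _ := GRing.Zmodule_isComNzRing.Build Zp
  padic_mulA padic_mulC padic_mul1 padic_mulDl padic_1neq0.

Definition padic_unit : {pred Zp} := fun x => `[< exists y, y * x = 1 >].

Definition padic_inv x : Zp := xget x [set y | y * x = 1].

Lemma padic_mulV : {in padic_unit, left_inverse 1 padic_inv *%R}.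
Proof.
by move=> x /asboolP[y yx]; rewrite /padic_inv; case: xgetP => [z _ //|/(_ y)].
Qed.

Lemma padic_unitP x y : y * x = 1 -> padic_unit x.
Proof. by move=> yx; apply/asboolP; exists y. Qed.

Lemma padic_inv_out : {in [predC padic_unit], padic_inv =1 id}.
Proof.
move=> x; rewrite inE => /asboolP nx; rewrite /padic_inv.
by case: xgetP => // z _ zx; case: nx; exists z.
Qed.

HB.instance Definition _ := GRing.ComNzRing_hasMulInverse.Build Zp
  padic_mulV padic_unitP padic_inv_out.

Lemma padic_neq0 x : x != 0 -> exists n, x n != 0%N.
Proof.
move=> x0; apply: contrapT => nx; move/eqP: x0; apply; apply: padic_intP => n.
rewrite [RHS]/= mod0n; apply/eqP; apply: contrapT => xn.
by apply: nx; exists n; exact/negP.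
Qed.

Lemma padic_integral x y : x * y = 0 -> (x == 0) || (y == 0).
Proof.
move=> xy; case: (eqVneq x 0) => //= /padic_neq0[n xn].
apply: contrapT => /negP /padic_neq0[m ym].
have H z k l : z k != 0%N -> (0 < z (k + l))%N && (logn p (z (k + l)) < k)%N.
  rewrite -(padic_res_modD z k l) => zk.
  have z0 : (0 < z (k + l))%N.
    by rewrite lt0n; apply: contraNneq zk => ->; rewrite mod0n.
  by rewrite z0 /= ltnNge -pfactor_dvdn.
have /andP[x0 xl] := H _ _ m xn; have := H _ _ n ym.
rewrite addnC => /andP[y0 yl].
have /(congr1 (fun z : Zp => z (n + m)%N)) /= := xy.
rewrite mod0n => /eqP; rewrite -/(dvdn _ _) pfactor_dvdn // ?muln_gt0 ?x0 //.
by rewrite lognM // leqNgt -addSn leq_add // ltnW.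
Qed.

HB.instance Definition _ :=
  GRing.ComUnitRing_isIntegral.Build Zp padic_integral.

End PadicInt.

Definition padic (p : nat) (p_pr : prime p) := {fraction padic_int p_pr}.

HB.instance Definition _ (p : nat) (p_pr : prime p) :=
  GRing.Field.on (padic p_pr).

Section Padic.
Variables (p : nat) (p_pr : prime p).
Local Notation Zp := (padic_int p_pr).
Local Notation Qp := (padic p_pr).

Definition padic_of_int : Zp -> Qp := @FracField.tofrac Zp.

Definition padic_ball (x : Qp) (n : int) : set Qp :=
  [set x + p%:R ^ n * padic_of_int z | z in setT].

Definition padic_open : set_system Qp :=
  [set U | forall x, U x -> exists n : nat, padic_ball x n `<=` U].

Lemma padic_openT : padic_open setT.
Proof. by move=> x _; exists 0%N. Qed.

Lemma padic_ballS (x : Qp) (n m : nat) : (n <= m)%N ->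
  padic_ball x m `<=` padic_ball x n.
Proof.
move=> nm _ [z _ <-]; exists (p%:R ^+ (m - n) * z) => //.
rewrite /padic_of_int rmorphM rmorphXn rmorph_nat mulrA.
by rewrite -!exprnP -exprD subnKC.
Qed.

Lemma padic_openI : setI_closed padic_open.
Proof.
move=> A B oA oB x [/oA[n nA] /oB[m mB]]; exists (maxn n m) => z xz; split.
  by apply: nA; apply: padic_ballS xz; exact: leq_maxl.
by apply: mB; apply: padic_ballS xz; exact: leq_maxr.
Qed.

Lemma padic_open_bigcup (I : Type) (f : I -> set Qp) :
  (forall i, padic_open (f i)) -> padic_open (\bigcup_i f i).
Proof.
move=> of_ x [i _ /of_[n nf]]; exists n => y /nf fy; by exists i.
Qed.

HB.instance Definition _ := isPointed.Build Qp 0.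
HB.instance Definition _ := isOpenTopological.Build Qp
  padic_openT padic_openI padic_open_bigcup.

End Padic.

Definition borel_padic (p : nat) (p_pr : prime p) :=
  g_sigma_algebraType (@open (padic p_pr)).

Section Definitions.
Variables (p : nat) (p_pr : prime p).
Local Notation Qp := (padic p_pr).

Definition pZp : set Qp := padic_ball 0 1.

(* Haar measure normalized by mu(p Z_p) = 1; no regularity clause is needed,
   every locally finite Borel measure on Q_p being regular. *)
Definition normalized_haar (R : realType)
    (mu : {measure set (borel_padic p_pr) -> \bar R}) : Prop :=
  [/\ (forall (a : Qp) (A : set Qp), measurable (A : set (borel_padic p_pr)) ->
         mu ([set a + x | x in A] : set Qp) = mu A),
      (forall K : set Qp, compact K -> (mu K < +oo)%E)
    & mu pZp = 1%E].

Definition padic_val (y : rat) : \bar int :=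
  if y == 0 then +oo%E
  else ((logn p `|numq y|%N)%:Z - (logn p `|denq y|%N)%:Z)%:E.

Definition Zinvp : set rat :=
  [set y | exists (m : int) (j : nat), y = m%:~R / p%:R ^+ j].

Definition calT : set rat := Zinvp `&` [set y : rat | - (1 / 2) < y < 1 / 2].

(* alpha = \sum_(j >= 0) c_j p^(j - r), with digits in {-(p-1)/2,..,(p-1)/2}:
   c_j is the digit of index j - r. Leading zero digits are allowed, so that r
   may be taken to be a natural number. *)
Definition balanced_expansion (alpha : Qp) (r : nat) (c : nat -> int) : Prop :=
  (forall j, - ((p.-1)./2)%:Z <= c j <= ((p.-1)./2)%:Z) /\
  (fun N : nat => \sum_(j < N) (c j)%:~R * p%:R ^ (j%:Z - r%:Z) : Qp)
    @ \oo --> alpha.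

Definition digit_sum (r : nat) (c : nat -> int) (N : nat) : rat :=
  \sum_(j < N) (c j)%:~R * p%:R ^ (j%:Z - r%:Z).

(* [xget] picks the value determined by the (unique) balanced expansion: the
   first r + 1 digits are those of index -r..0, the first r those of index
   -r..-1. *)
Definition floor_s (alpha : Qp) : rat :=
  xget 0 [set x | exists r c,
    balanced_expansion alpha r c /\ x = digit_sum r c r.+1].

Definition floor_t (alpha : Qp) : rat :=
  xget 0 [set x | exists r c,
    balanced_expansion alpha r c /\ x = digit_sum r c r].

Definition floor_st (n : nat) : Qp -> rat := if odd n then floor_t else floor_s.

(* alpha_n, or [None] if the algorithm has stopped before step n *)
Fixpoint complete_quotient (alpha : Qp) (n : nat) : option Qp :=
  if n is m.+1 then
    if complete_quotient alpha m is Some beta then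
      let a := ratr (floor_st m beta) in
      if beta == a then None else Some (beta - a)^-1
    else None
  else Some alpha.

Definition partial_quotient (alpha : Qp) (n : nat) : option rat :=
  omap (floor_st n) (complete_quotient alpha n).

Definition odd_frequency (R : realType) (alpha : Qp) (y : rat) (n : nat) : R :=
  #|[pred i : 'I_n | partial_quotient alpha (2 * i + 1)%N == Some y]|%:R / n%:R.

End Definitions.

Arguments pZp {p} p_pr.

(* Main.v *)
From HB Require Import structures.
Require Import Defs.
From mathcomp Require Import all_boot all_order all_algebra cyclic.
From mathcomp Require Import zify ring lra.
From mathcomp Require Import all_classical all_reals all_analysis.
From mathcomp Require Import measurable_realfun.

(* Two steps of the algorithm send [alpha = 1 / (a + 1 / (b + x))] to [x], where
   [a] ranges over the nonzero values of [t], [b] over the nonzero values of [s]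
   and [x] over all of [pZp]: the induced map of [pZp] has full branches. The
   inverse branch attached to [(a, b)] multiplies the radius of every ball by the
   constant [p^(2 v(a) + 2 v(b))], so the successive pairs of partial quotients
   are independent and identically distributed for [mu]. Up to one point,
   [a_1 = y] is the ball of centre [1 / y] and radius [p^(-2k)], of measure
   [p^(1 - 2k)], and the theorem is the strong law of large numbers for pairwise
   independent events. *)

Set Implicit Arguments.
Unset Strict Implicit.
Unset Printing Implicit Defensive.

Import Order.TTheory GRing.Theory Num.Theory.
Import numFieldNormedType.Exports.
Local Open Scope classical_set_scope.
Local Open Scope ring_scope.

(** * p-adic integers and valuations *)

Section PadicIntTheory.
Variables (p : nat) (p_pr : prime p).
Local Notation Zp := (padic_int p_pr).
Implicit Types x y z : Zp.

(** [t] fixes a number modulo [Z_p] and [s] modulo [p Z_p], so a nonzero [a] has valuation at most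
    -1 and a nonzero [b] at most 0. For [x] in [pZp] the sum [b + x] keeps the valuation of [b], so
    its inverse lies in [Z_p] and is invisible to [t]. This is why every pair accepts every [x], and
    why the two floors are handled as one step. Inversion multiplies the radius of a small ball
    around a point of valuation [v] by [p^(2v)], which explains the constant. A single step fails
    only at [0] and at inverses of rational numbers, a null set. Pairwise independence suffices
    because the law of large numbers is obtained from second moments along the squares. *)

Lemma padic_natrE (m n : nat) : (m%:R : Zp) n = (m %% p ^ n)%N.
Proof.
elim: m n => [|m IH] n; first by [].
rewrite -natr1 [LHS]/= IH.
by case: n => [|n]; rewrite ?modn1 // modnDml modnDmr addn1.
Qed.

Lemma padic_addE x y n : (x + y) n = ((x n + y n) %% p ^ n)%N.
Proof. by []. Qed.

Lemma padic_mulE x y n : (x * y) n = ((x n * y n) %% p ^ n)%N.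
Proof. by []. Qed.

Lemma padic_res_lt x n : (x n < p ^ n)%N.
Proof. by rewrite -(padic_res_mod x n) ltn_mod expn_gt0 prime_gt0. Qed.

Lemma padic_opp_res0 x n : x n = 0%N -> (- x) n = 0%N.
Proof. by move=> x0; rewrite [LHS]/= x0 muln0 mod0n. Qed.

Lemma padic_dvd_exp x n : x n = 0%N -> exists z, x = p%:R ^+ n * z.
Proof.
move=> x0.
have pn0 : (0 < p ^ n)%N by rewrite expn_gt0 prime_gt0.
have zP m : ((x (n + m.+1) %/ p ^ n) %% p ^ m)%N = (x (n + m) %/ p ^ n)%N.
  by rewrite modn_divl -expnD addnC addSn padic_resP addnC.
exists (PadicInt p_pr zP); apply: padic_intP => m.
rewrite padic_mulE -natrX padic_natrE modnMml /=.
have /dvdnP[k kE] : (p ^ n %| x (n + m))%N.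
  by rewrite /dvdn padic_res_modD x0.
by rewrite kE mulnK // mulnC -kE addnC padic_res_modD.
Qed.

Lemma padic_dvd_expE x n z : x = p%:R ^+ n * z -> x n = 0%N.
Proof. by move=> ->; rewrite padic_mulE -natrX padic_natrE modnn mul0n mod0n. Qed.

(** Euler's theorem gives the inverse modulo each [p ^ n] as a power; these residues are compatible
    because an inverse modulo [p ^ n] is unique. *)
Lemma padic_unitE x : x 1%N != 0%N -> x \is a GRing.unit.
Proof.
move=> x1.
have cop n : coprime (x n) (p ^ n).
  case: n => [|n]; first by rewrite expn0 coprimen1.
  rewrite coprime_pexpr // coprime_sym prime_coprime //.
  by have := padic_res_modD x 1 n; rewrite expn1 add1n /dvdn => ->.
have inv n : (x n * x n ^ (totient (p ^ n)).-1 = 1 %[mod p ^ n])%N.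
  by rewrite -expnS prednK ?Euler_exp_totient // totient_gt0 expn_gt0 prime_gt0.
have yP : padic_mk_proof p (fun n => x n ^ (totient (p ^ n)).-1)%N.
  move=> n; set a := (x n.+1 ^ _)%N; set b := (x n ^ _)%N.
  have xa : (x n * a = 1 %[mod p ^ n])%N.
    rewrite -modnMml -(padic_resP x n) modn_mod modnMml.
    have := inv n.+1; rewrite -/a => /(congr1 (modn^~ (p ^ n)%N)).
    by rewrite !modn_dvdm // dvdn_exp2l.
  have xb : (x n * b = 1 %[mod p ^ n])%N := inv n.
  rewrite -[a]muln1 -modnMmr -xb modnMmr mulnCA mulnA -modnMml xa.
  by rewrite modnMml mul1n.
apply/unitrP; exists (padic_mk p_pr yP).
suff H : padic_mk p_pr yP * x = 1 by split=> //; rewrite mulrC.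
apply: padic_intP => n; rewrite padic_mulE /= modnMml mulnC inv.
by [].
Qed.

Lemma padic_unit_res1 x : x \is a GRing.unit -> x 1%N != 0%N.
Proof.
move=> /unitrP[y [yx _]]; apply/eqP => x1.
have /(congr1 (fun z : Zp => z 1%N)) := yx.
rewrite padic_mulE x1 muln0 mod0n -[X in _ = padic_res X _]/(1%:R : Zp) padic_natrE.
by rewrite expn1 modn_small // prime_gt1.
Qed.

Lemma padic_int_factor x : x != 0 ->
  exists n (u : Zp), u \is a GRing.unit /\ x = p%:R ^+ n * u.
Proof.
move=> /padic_neq0 ex; case: (ex_minnP ex) => -[|n] xn minn.
  by move: xn; rewrite -(padic_res_mod x 0) modn1.
have xn0 : x n = 0%N.
  by apply/eqP; apply: contraTT (ltnSn n); rewrite -leqNgt; exact: minn.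
have [u xE] := padic_dvd_exp xn0; exists n, u; split => //.
apply: padic_unitE; apply: contraNneq xn => /padic_dvd_exp[z uE].
by apply/eqP; apply: (@padic_dvd_expE _ _ z); rewrite xE uE expr1 exprSr mulrA.
Qed.

End PadicIntTheory.

Lemma invfB_mul (F : fieldType) (x y : F) : x != 0 -> y != 0 ->
  y^-1 - x^-1 = (x - y) * (x^-1 * y^-1).
Proof. by move=> x0 y0; field; exact/andP. Qed.

(** * Fractional ideals, valuations and balls of [Q_p] *)

Section PadicTheory.
Variables (p : nat) (p_pr : prime p).
Local Notation Zp := (padic_int p_pr).
Local Notation Qp := (padic p_pr).
Local Notation iota := (@padic_of_int p p_pr).
Implicit Types (x y : Qp) (z : Zp) (m n : int).

HB.instance Definition _ := GRing.RMorphism.on iota.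

Lemma padic_of_int_inj : injective iota.
Proof. by move=> x y; move/eqP; rewrite /padic_of_int tofrac_eq => /eqP. Qed.

Lemma padic_frac x : exists a b : Zp, b != 0 /\ x = iota a / iota b.
Proof.
elim/quotW: x => x; exists (frac x).1, (frac x).2; split; first exact: denom_ratioP.
rewrite /padic_of_int.
apply: (canRL (mulfK _)); first by rewrite tofrac_eq0 denom_ratioP.
rewrite -[_ * _]/(FracField.mul _ _) !piE.
apply/eqmodP; rewrite /= /FracField.equivf /FracField.mulf.
by rewrite !numden_Ratio ?mul1r ?mulr1 ?oner_eq0 ?denom_ratioP // mulrC.
Qed.

(** The fractional ideal [p^n Z_p], that is [|x| <= p^-n]: ultrametric estimates become
    memberships. *)
Definition pideal n : set Qp := [set p%:R ^ n * iota z | z in setT].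

Lemma padic_ballE x n y : padic_ball x n y <-> pideal n (y - x).
Proof.
split=> [[z _ <-]|[z _ zE]]; exists z => //; first by rewrite addrC addKr.
by rewrite zE addrCA subrr addr0.
Qed.

Lemma padic_of_int_natr k : iota k%:R = k%:R.
Proof. exact: rmorph_nat. Qed.

Lemma padic_of_intD : {morph iota : a b / a + b}. Proof. exact: rmorphD. Qed.
Lemma padic_of_intN : {morph iota : a / - a}. Proof. exact: rmorphN. Qed.
Lemma padic_of_intM : {morph iota : a b / a * b}. Proof. exact: rmorphM. Qed.
Lemma padic_of_intX k : {morph iota : a / a ^+ k}. Proof. exact: rmorphXn. Qed.
Lemma padic_of_int0 : iota 0 = 0. Proof. exact: rmorph0. Qed.
Lemma padic_of_int1 : iota 1 = 1. Proof. exact: rmorph1. Qed.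
Lemma padic_of_int_int k : iota k%:~R = k%:~R. Proof. exact: rmorph_int. Qed.
Lemma padic_of_intV : {in GRing.unit, {morph iota : a / a^-1}}.
Proof. exact: rmorphV. Qed.

Lemma padic_natr_eq0 k : ((k%:R : Qp) == 0) = (k == 0%N).
Proof.
apply/eqP/eqP => [|->//]; rewrite -padic_of_int_natr -padic_of_int0.
move=> /padic_of_int_inj /(congr1 (fun z : Zp => z k)).
rewrite padic_natrE [RHS]/= mod0n modn_small //.
by rewrite ltn_expl // prime_gt1.
Qed.

Let p0 : (p%:R : Qp) != 0.
Proof. by rewrite padic_natr_eq0 -lt0n prime_gt0. Qed.

Lemma pidealD n x y : pideal n x -> pideal n y -> pideal n (x + y).
Proof.
by move=> [z _ <-] [t _ <-]; exists (z + t) => //; rewrite padic_of_intD mulrDr.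
Qed.

Lemma pidealN n x : pideal n x -> pideal n (- x).
Proof. by move=> [z _ <-]; exists (- z) => //; rewrite padic_of_intN mulrN. Qed.

Lemma pidealB n x y : pideal n x -> pideal n y -> pideal n (x - y).
Proof. by move=> xn yn; exact/pidealD/pidealN. Qed.

Lemma pidealBC n x y : pideal n (x - y) -> pideal n (y - x).
Proof. by move=> /pidealN; rewrite opprB. Qed.

Lemma pidealM m n x y : pideal m x -> pideal n y -> pideal (m + n) (x * y).
Proof.
move=> [z _ <-] [t _ <-]; exists (z * t) => //.
by rewrite padic_of_intM expfzDr // mulrACA.
Qed.

Lemma pideal0 n : pideal n 0.
Proof. by exists 0 => //; rewrite padic_of_int0 mulr0. Qed.

Lemma pideal_iota z : pideal 0 (iota z).
Proof. by exists z => //; rewrite expr0z mul1r. Qed.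

Lemma pideal_exp n : pideal n (p%:R ^ n).
Proof. by exists 1 => //; rewrite padic_of_int1 mulr1. Qed.

Lemma pideal_le m n : n <= m -> pideal m `<=` pideal n.
Proof.
move=> nm x; have [k ->] : exists k : nat, m = n + k%:Z.
  by exists `|m - n|%N; lia.
move=> [z _ <-]; exists (p%:R ^+ k * z) => //.
by rewrite padic_of_intM padic_of_intX padic_of_int_natr mulrA expfzDr.
Qed.

Lemma pideal_int (m : int) : pideal 0 m%:~R.
Proof. by rewrite -padic_of_int_int; exact: pideal_iota. Qed.

(** Brings divisibility in [Q_p] back to the integers, where it can be played against an archimedean
    bound. *)
Lemma pideal_nat_dvd (k : nat) (m : int) :
  pideal k m%:~R -> (p ^ k %| `|m|)%N.
Proof.
move=> [z _]; rewrite -padic_of_int_int -exprnP.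
rewrite -padic_of_int_natr -padic_of_intX -padic_of_intM.
move=> /padic_of_int_inj zm.
have mz : (m%:~R : Zp) k = 0%N by apply: padic_dvd_expE; exact: esym zm.
suff: ((`|m|%N%:R : Zp) k = 0)%N by rewrite padic_natrE => /eqP.
have [m0|m0] := leP 0 m; first by rewrite -[RHS]mz -[in RHS](gez0_abs m0).
by rewrite -[RHS](padic_opp_res0 mz) -mulrNz -[in RHS](ltz0_abs m0).
Qed.

(** A relation rather than a function: [0] has no valuation, and no default value has to be
    tracked. *)
Definition pval x n := exists2 u : Zp, u \is a GRing.unit & x = p%:R ^ n * iota u.

Lemma pval_neq0 x n : pval x n -> x != 0.
Proof.
move=> [u uu ->]; apply: mulf_neq0; first exact: expfz_neq0.
rewrite -padic_of_int0 (inj_eq padic_of_int_inj).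
by apply: contraTneq uu => ->; rewrite unitr0.
Qed.

Lemma pval_ex x : x != 0 -> exists n, pval x n.
Proof.
have [a [b [b0 ->]]] := padic_frac x => x0.
have a0 : a != 0 by apply: contra_neq x0 => ->; rewrite padic_of_int0 mul0r.
have [n [u [uu aE]]] := padic_int_factor a0.
have [m [v [vu bE]]] := padic_int_factor b0.
exists (n%:Z - m%:Z); exists (u / v); first by rewrite unitrMl // unitrV.
rewrite aE bE !padic_of_intM !padic_of_intX padic_of_int_natr padic_of_intV //.
rewrite expfzDr // -invr_expz.
by rewrite invfM mulrACA -!exprnP.
Qed.

Lemma pvalV x n : pval x n -> pval x^-1 (- n).
Proof.
move=> [u uu ->]; exists (u^-1); first by rewrite unitrV.
by rewrite invfM padic_of_intV // -invr_expz.
Qed.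

Lemma pval_pideal x n : pval x n -> pideal n x.
Proof. by move=> [u _ ->]; exists u. Qed.

Lemma pvalM x y m n : pval x m -> pval y n -> pval (x * y) (m + n).
Proof.
move=> [u uu ->] [v vu ->]; exists (u * v); first by rewrite unitrMl.
by rewrite padic_of_intM expfzDr // mulrACA.
Qed.

Lemma pidealS_pval x n : pval x n -> ~ pideal (n + 1) x.
Proof.
move=> xn px.
have [u uu xE] := xn.
have := pidealM (pideal_exp (- n)) px.
rewrite addKr xE mulrA -expfzDr // addNr expr0z mul1r => -[z _ /esym].
rewrite -exprnP -padic_of_int_natr -padic_of_intX -padic_of_intM => /padic_of_int_inj uE.
by have := padic_unit_res1 uu; rewrite (padic_dvd_expE uE).
Qed.

Lemma pval_le x m n : pval x n -> pideal m x -> m <= n.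
Proof.
move=> xn xm; rewrite leNgt; apply/negP => nm; apply: (pidealS_pval xn).
by apply: pideal_le xm; lia.
Qed.

Lemma pval_eq x n : pideal n x -> ~ pideal (n + 1) x -> pval x n.
Proof.
move=> xn xn1; have [x0|/pval_ex[m xm]] := eqVneq x 0.
  by case: xn1; rewrite x0; exact: pideal0.
have nm := pval_le xm xn.
have mn : m <= n.
  rewrite leNgt; apply/negP => nm'; apply: xn1.
  by apply: pideal_le (pval_pideal xm); lia.
by have -> : n = m by apply/eqP; rewrite eq_le nm mn.
Qed.

Lemma pval_ltP x n : ~ pideal n x -> exists2 m, m < n & pval x m.
Proof.
move=> xn; have [x0|/pval_ex[m xm]] := eqVneq x 0.
  by case: xn; rewrite x0; exact: pideal0.
exists m => //; rewrite ltNge; apply/negP => nm; apply: xn.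
by apply: pideal_le (pval_pideal xm).
Qed.

Lemma pvalD x y n m : n < m -> pval x n -> pideal m y -> pval (x + y) n.
Proof.
move=> nm xn ym; apply: pval_eq.
  by apply: pidealD (pval_pideal xn) (pideal_le _ ym); exact: ltW.
move=> /pidealB xy; apply: (pidealS_pval xn).
have := xy _ (@pideal_le m (n + 1) _ _ ym).
by rewrite addrK; apply; lia.
Qed.

(** [1/y - 1/x = (x - y) / (xy)], and [y] has the valuation of [x] because the ball avoids [0]: the
    exponent changes by [-2n]. *)
Lemma padic_ball_inv_sub x n m : n < m -> pval x n ->
  forall y, padic_ball x m y -> padic_ball x^-1 (m - 2 * n) y^-1.
Proof.
move=> nm xn y /padic_ballE xy.
have yn : pval y n by rewrite -(subrK x y) addrC; exact: pvalD xy.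
have x0 := pval_neq0 xn; have y0 := pval_neq0 yn.
apply/padic_ballE.
have -> : y^-1 - x^-1 = (x - y) * (x^-1 * y^-1) by exact: invfB_mul.
have -> : m - 2 * n = m + (- n - n) by lia.
apply: pidealM; first exact: pidealBC.
by apply: pval_pideal; apply: pvalM; exact: pvalV.
Qed.

(** Inversion is an involution, so the converse inclusion is the direct one around [x^-1]. *)
Lemma padic_ball_inv x n m : n < m -> pval x n ->
  [set y^-1 | y in padic_ball x m] = padic_ball x^-1 (m - 2 * n).
Proof.
move=> nm xn; apply/seteqP; split=> [_ [y xy <-]|y xy].
  exact: padic_ball_inv_sub xy.
exists y^-1; last exact: invrK.
have -> : m = (m - 2 * n) - 2 * (- n) by lia.
rewrite -[x]invrK; apply: padic_ball_inv_sub xy; last exact: pvalV.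
by lia.
Qed.

Lemma padic_ball_add c x m :
  [set c + y | y in padic_ball x m] = padic_ball (c + x) m.
Proof.
apply/seteqP; split=> [_ [y /padic_ballE xy <-]|y /padic_ballE xy].
  by apply/padic_ballE; rewrite opprD addrACA subrr add0r.
exists (y - c); last by rewrite addrC subrK.
by apply/padic_ballE; rewrite -addrA -opprD.
Qed.

Lemma padic_ball_center x m : padic_ball x m x.
Proof. by apply/padic_ballE; rewrite subrr; exact: pideal0. Qed.

Lemma pZpE x : pZp p_pr x <-> pideal 1 x.
Proof. by split=> [/padic_ballE|px]; last apply/padic_ballE; rewrite subr0. Qed.

Lemma padic_ball_eq x y m : padic_ball x m y -> padic_ball x m = padic_ball y m.
Proof.
move=> /padic_ballE xy; apply/seteqP; split=> z /padic_ballE xz; apply/padic_ballE.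
  by have := pidealB xz xy; rewrite opprB addrA subrK.
by have := pidealD xz xy; rewrite addrA subrK.
Qed.

End PadicTheory.

(** * Balanced expansions *)

(** [ratr] is defined through the reduced fraction, while elements of [Z[1/p]] come with a power of
    [p] that may not be the reduced denominator; cross-multiplication reconciles the two. *)
Lemma ratr_frac (F : fieldType) (m : int) (d : nat) :
  (forall k, ((k%:R : F) == 0) = (k == 0%N)) -> d != 0%N ->
  ratr (m%:~R / d%:R) = m%:~R / d%:R :> F.
Proof.
move=> charF d0; set y := m%:~R / d%:R.
have intF (k : int) : ((k%:~R : F) == 0) = (k == 0).
  by case: k => k; rewrite ?NegzE ?mulrNz ?oppr_eq0 charF.
have dF : (d%:R : F) != 0 by rewrite charF.
have dQ : (d%:R : rat) != 0 by rewrite pnatr_eq0.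
have nd : numq y * d%:Z = m * denq y.
  apply/eqP; rewrite -(eqr_int rat) !intrM /= -[d%:Z%:~R]/(d%:R).
  by rewrite (numqE y) mulrAC /y divfK.
rewrite /ratr; apply/eqP; rewrite eqr_div ?intF ?denq_neq0 //.
by rewrite -[d%:R]/(d%:Z%:~R) -!intrM nd.
Qed.

Lemma sum_digits (F : fieldType) (p : nat) (c : nat -> int) (r N : nat) :
  (p%:R : F) != 0 ->
  \sum_(j < N) (c j)%:~R * p%:R ^ (j%:Z - r%:Z) =
  (\sum_(j < N) c j * p%:Z ^+ j)%:~R / p%:R ^+ r :> F.
Proof.
move=> p0; rewrite rmorph_sum /= mulr_suml; apply: eq_bigr => j _.
by rewrite expfzDr // -invr_expz -!exprnP rmorphM rmorphXn mulrA.
Qed.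

(** Since [2 |c j| <= p - 1], twice the sum is at most [(p - 1)(1 + ... + p^(N-1)) = p^N - 1] in
    absolute value. *)
Lemma balanced_sum_lt (p : nat) (c : nat -> int) (N : nat) : (0 < p)%N ->
  (forall j, - ((p.-1)./2)%:Z <= c j <= ((p.-1)./2)%:Z) ->
  2 * `|\sum_(j < N) c j * p%:Z ^+ j| < p%:Z ^+ N.
Proof.
move=> p0 cP; elim: N => [|N IH]; first by rewrite big_ord0.
rewrite big_ord_recr /= exprS.
apply: le_lt_trans (ler_wpM2l _ (ler_normD _ _)) _ => //.
rewrite normrM (ger0_norm (exprn_ge0 _ _)) // mulrDr.
have : 2 * `|c N| <= p%:Z - 1 by have := cP N; lia.
move=> cN; have := ler_wpM2r (exprn_ge0 N (ler0n int p)) cN.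
move: IH; rewrite pmulrn intz.
by set P := p%:Z ^+ N; set S := `|\sum_(i < N) _|; set C := `|c N|; nia.
Qed.

Section Floor.
Variables (p : nat) (p_pr : prime p).
Local Notation Zp := (padic_int p_pr).
Local Notation Qp := (padic p_pr).
Local Notation iota := (@padic_of_int p p_pr).

Let p0 : (p%:R : Qp) != 0.
Proof. by rewrite padic_natr_eq0 -lt0n prime_gt0. Qed.

Let pQ0 : (p%:R : rat) != 0.
Proof. by rewrite pnatr_eq0 -lt0n prime_gt0. Qed.

Lemma ratr_Zinvp (m : int) (j : nat) :
  ratr (m%:~R / p%:R ^+ j) = m%:~R / p%:R ^+ j :> Qp.
Proof.
rewrite -!natrX ratr_frac //; first exact: padic_natr_eq0.
by rewrite -lt0n expn_gt0 prime_gt0.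
Qed.

Lemma nbhs_padicE (x : Qp) (U : set Qp) :
  nbhs x U <-> exists n : nat, padic_ball x n `<=` U.
Proof.
split=> [|[n nU]].
  rewrite nbhsE => -[V [oV Vx] VU].
  by have [n nV] := oV x Vx; exists n => y /nV /VU.
rewrite nbhsE; exists (padic_ball x n) => //; split; last exact: padic_ball_center.
by move=> y xy; exists n; rewrite (padic_ball_eq xy).
Qed.

Lemma padic_cvgP (u : nat -> Qp) (a : Qp) :
  u @ \oo --> a <-> forall n : nat, \forall k \near \oo, pideal n (u k - a).
Proof.
split=> [ua n|ua U /nbhs_padicE[n nU]].
  have : \forall k \near \oo, padic_ball a n (u k).
    by apply: ua; apply/nbhs_padicE; exists n.
  by apply: filterS => k /padic_ballE.
by apply: filterS (ua n) => k uk; apply: nU; apply/padic_ballE.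
Qed.

(* The case [e = 0] characterizes [floor_t], the case [e = 1] [floor_s]. *)
Definition is_floor (e : nat) (a : Qp) (x : rat) :=
  [/\ Zinvp p x, `|x| < p%:R ^+ e / 2 & pideal e (a - ratr x)].

(** Two candidates differ by an element of [Z[1/p]] lying in [p^e Z_p], hence by an integer multiple
    of [p^e], and by less than [p^e] in absolute value. This takes the place of the uniqueness of
    balanced expansions. *)
Lemma is_floor_unique e a x x' : is_floor e a x -> is_floor e a x' -> x = x'.
Proof.
move=> [[m [j xE]] xlt xa] [[m' [j' xE']] xlt' xa'].
have P n : 0 < (p%:R : rat) ^+ n by rewrite exprn_gt0 // ltr0n prime_gt0.
pose n := m * p%:Z ^+ j' - m' * p%:Z ^+ j.
have diffE (F : fieldType) : (p%:R : F) != 0 ->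
    m%:~R / p%:R ^+ j - m'%:~R / p%:R ^+ j' = n%:~R / p%:R ^+ (j + j') :> F.
  move=> pF; rewrite /n rmorphB !rmorphM !rmorphXn /= exprD.
  by field; rewrite !expf_neq0.
have dvd : (p ^ (j + j' + e) %| `|n|)%N.
  apply: (@pideal_nat_dvd _ p_pr).
  have -> : n%:~R = p%:R ^ (j + j')%N * (m%:~R / p%:R ^+ j - m'%:~R / p%:R ^+ j') :> Qp.
    by rewrite diffE // mulrC -exprnP divfK // expf_neq0.
  rewrite PoszD; apply: pidealM; first exact: pideal_exp.
  rewrite -!ratr_Zinvp -xE -xE'.
  by have := pidealB xa' xa; rewrite opprB addrC addrA subrK.
have xx' : x - x' = n%:~R / p%:R ^+ (j + j') by rewrite xE xE' diffE.
apply/eqP; rewrite -subr_eq0 xx' mulf_eq0 invr_eq0 expf_eq0 (negPf pQ0) andbF orbF.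
rewrite intr_eq0 -absz_eq0; apply: contraTT dvd => n0.
rewrite gtnNdvd ?lt0n // -(ltr_nat rat) natrX natr_absz.
rewrite exprD mulrC -ltr_pdivrMr // intr_norm.
rewrite -[X in _ / X]gtr0_norm // -normf_div -xx'.
by apply: le_lt_trans (ler_normB _ _) _; lra.
Qed.

Lemma padic_congr (x : Zp) N : exists t : Zp, x = (x N)%:R + p%:R ^+ N * t.
Proof.
suff /padic_dvd_exp[t tE] : (x - (x N)%:R) N = 0%N.
  by exists t; rewrite -tE addrC subrK.
have : ((x - (x N)%:R) + (x N)%:R) N = x N by rewrite subrK.
rewrite padic_addE padic_natrE padic_res_mod => /eqP.
rewrite -[X in _ == X]padic_res_mod -[X in _ == (X %% _)%N]add0n eqn_modDr mod0n.
by rewrite padic_res_mod => /eqP.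
Qed.

(** Some truncation beyond [N] is close to [a], and the digits in between contribute multiples of
    [p^(N-r)]. *)
Lemma balanced_expansion_sub (a : Qp) r c N : balanced_expansion a r c ->
  pideal (N%:Z - r%:Z)
    (a - (\sum_(j < N) c j * p%:Z ^+ j)%:~R / p%:R ^+ r).
Proof.
move=> [_ /padic_cvgP ca].
have [M _ /(_ (maxn M N)) MP] := ca N.
have {MP} := MP (leq_maxl _ _).
rewrite sum_digits //.
have := leq_maxr M N; move: (maxn M N) => K NK.
move=> /(@pideal_le _ p_pr _ (N%:Z - r%:Z)) aK'.
have aK := aK' ltac:(lia).
rewrite -(subrK ((\sum_(j < K) c j * p%:Z ^+ j)%:~R / p%:R ^+ r) a) -addrA.
apply: pidealD; first exact: pidealBC.
have -> : \sum_(j < K) c j * p%:Z ^+ j =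
    \sum_(j < N) c j * p%:Z ^+ j + \sum_(N <= j < K) c j * p%:Z ^+ j.
  by rewrite -!(big_mkord xpredT (fun j => c j * p%:Z ^+ j)) -big_cat_nat.
rewrite -mulrBl rmorphD /= [X in pideal _ (X / _)]addrAC subrr add0r.
apply: pidealM; last first.
  rewrite exprnP invr_expz; exact: pideal_exp.
rewrite big_nat; elim/big_ind: _ => [|x y|j /andP[Nj _]].
- exact: pideal0.
- by rewrite rmorphD; exact: pidealD.
rewrite rmorphM rmorphXn /= -[X in pideal X]add0r.
rewrite -pmulrn; apply: pidealM; first exact: pideal_int.
by apply: (@pideal_le _ _ j%:Z) => //; exact: pideal_exp.
Qed.

Lemma balanced_expansion_floor e (a : Qp) r c : balanced_expansion a r c ->
  is_floor e a (digit_sum p r c (r + e)).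
Proof.
move=> ce; have := balanced_expansion_sub (r + e) ce.
rewrite -ratr_Zinvp /digit_sum sum_digits // => cp; split.
- by eexists; eexists.
- have := balanced_sum_lt (r + e) (prime_gt0 p_pr) ce.1.
  rewrite -(ltr_int rat) intrM intr_norm.
  have P n : 0 < (p%:R : rat) ^+ n by rewrite exprn_gt0 // ltr0n prime_gt0.
  rewrite normf_div (gtr0_norm (P r)) ltr_pdivrMr // rmorphXn /= exprD.
  by set u := p%:R ^+ r; set v := p%:R ^+ e; set w := `|_|; lra.
- by move: cp; rewrite PoszD addrC addKr.
Qed.

Hypothesis p_odd : odd p.

(** The integers [g n = (p^n - 1)/2 = h (1 + ... + p^(n-1))] are the residues of [-1/2]. Subtracting
    [h] from each ordinary digit of [z - 1/2] leaves the balanced digits of [z]. *)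
Lemma padic_int_balanced_expansion (z : Zp) : exists c : nat -> int,
  (forall j, - ((p.-1)./2)%:Z <= c j <= ((p.-1)./2)%:Z) /\
  forall N, exists t : Zp, z = (\sum_(j < N) c j * p%:Z ^+ j)%:~R + p%:R ^+ N * t.
Proof.
pose h := (p.-1)./2; have pE : p = (2 * h).+1 by rewrite /h; lia.
pose g n := ((p ^ n).-1)./2.
have gE n : (p ^ n = (2 * g n).+1)%N.
  have : odd (p ^ n) by rewrite oddX p_odd orbT.
  by rewrite /g; have : (0 < p ^ n)%N by [rewrite expn_gt0 prime_gt0]; lia.
have gS n : (g n.+1 = g n + h * p ^ n)%N.
  have := gE n.+1; rewrite expnS gE {1}pE; lia.
have gP : padic_mk_proof p g by move=> n; rewrite gS addnC modnMDl.
pose w := z + padic_mk p_pr gP.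
pose d j := (w j.+1 %/ p ^ j)%N.
have dlt j : (d j < p)%N.
  by rewrite ltn_divLR ?expn_gt0 ?prime_gt0 // -expnS padic_res_lt.
have wS j : w j.+1 = (d j * p ^ j + w j)%N.
  by rewrite {1}(divn_eq (w j.+1) (p ^ j)) padic_resP.
exists (fun j => (d j)%:Z - h%:Z); split=> [j|N]; first by have := dlt j; lia.
have -> : \sum_(j < N) ((d j)%:Z - h%:Z) * p%:Z ^+ j = (w N)%:Z - (g N)%:Z.
  elim: N => [|N IH].
    by rewrite big_ord0 -(padic_res_mod w 0) modn1.
  rewrite big_ord_recr [LHS]/= IH (wS N) gS !PoszD !PoszM.
  by rewrite -(natz (p ^ N)%N) natrX natz; ring.
have [t wt] := padic_congr w N.
have [t' gt] := padic_congr (padic_mk p_pr gP) N.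
exists (t - t').
have gN : padic_mk p_pr gP N = g N by rewrite /= modn_small // gE; lia.
rewrite gN in gt.
have -> : z = w - padic_mk p_pr gP by rewrite /w addrK.
by rewrite {1}wt {1}gt rmorphB /= mulrBr opprD addrACA.
Qed.

(** Existence keeps [xget] away from its default value in both floors. *)
Lemma balanced_expansion_exists (a : Qp) : exists r c, balanced_expansion a r c.
Proof.
have [r [z aE]] : exists (r : nat) (z : Zp), a = iota z / p%:R ^+ r.
  have [->|/pval_ex[n /pval_pideal an]] := eqVneq a 0.
    by exists 0%N, 0; rewrite padic_of_int0 mul0r.
  have : pideal (- `|n|%N%:Z) a by apply: pideal_le an; lia.
  move=> [z _ <-]; exists `|n|%N, z.
  by rewrite mulrC -invr_expz.
have [c [cP cz]] := padic_int_balanced_expansion z.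
exists r, c; split => //; apply/padic_cvgP => n.
exists (n + r)%N => // N /= nN; rewrite sum_digits // aE -mulrBl.
have [t ->] := cz N.
rewrite padic_of_intD padic_of_int_int opprD addNKr.
rewrite padic_of_intM padic_of_intX padic_of_int_natr.
have -> : n = (n + r)%N%:Z - r%:Z :> int by lia.
apply: pidealM; last by rewrite exprnP invr_expz; exact: pideal_exp.
by apply: pidealN; apply: (@pideal_le _ _ N%:Z) => //; exists t.
Qed.

Lemma floor_sP (a : Qp) : is_floor 1 a (floor_s a).
Proof.
rewrite /floor_s; case: xgetP => [x _ [r [c [ac ->]]]|no].
  by have := balanced_expansion_floor 1 ac; rewrite addn1.
have [r [c ac]] := balanced_expansion_exists a.
by case: (no (digit_sum p r c r.+1)); exists r, c.
Qed.

Lemma floor_tP (a : Qp) : is_floor 0 a (floor_t a).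
Proof.
rewrite /floor_t; case: xgetP => [x _ [r [c [ac ->]]]|no].
  by have := balanced_expansion_floor 0 ac; rewrite addn0.
have [r [c ac]] := balanced_expansion_exists a.
by case: (no (digit_sum p r c r)); exists r, c.
Qed.

Lemma is_floor0 (e : nat) (a : Qp) : pideal e a -> is_floor e a 0.
Proof.
move=> ea; split.
- by exists 0, 0%N; rewrite mul0r.
- by rewrite normr0 divr_gt0 // exprn_gt0 // ltr0n prime_gt0.
- by have := ratr_Zinvp 0 0; rewrite !mul0r => ->; rewrite subr0.
Qed.

End Floor.

(** * Two steps of the algorithm *)

Section Dynamics.
Variables (p : nat) (p_pr : prime p).
Local Notation Qp := (padic p_pr).
Local Notation pZp := (pZp p_pr).
Implicit Types (x u a : Qp) (ab : rat * rat).

Lemma is_floor_shift e (q : rat) a u :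
  is_floor e a q -> pideal e u -> is_floor e (ratr q + u : Qp) q.
Proof. by move=> [qZ qlt _] eu; split => //; rewrite addrC addKr. Qed.

Lemma is_floor_id e (q : rat) a : is_floor e a q -> is_floor e (ratr q : Qp) q.
Proof.
by move=> qa; rewrite -[ratr q]addr0; apply: is_floor_shift qa _; exact: pideal0.
Qed.

(** Otherwise [0] would be a second floor of the same number. *)
Lemma is_floor_neq0 e (q : rat) : q != 0 -> is_floor e (ratr q : Qp) q ->
  ~ pideal e (ratr q : Qp).
Proof.
move=> q0 qe /is_floor0 => H; move/eqP: q0; apply.
exact: is_floor_unique qe H.
Qed.

(* The possible values [(a_(2i+1), a_(2i+2))] of two consecutive partial
   quotients. *)
Definition digit_pair ab :=
  [/\ ab.1 != 0, ab.2 != 0, is_floor 0 (ratr ab.1 : Qp) ab.1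
    & is_floor 1 (ratr ab.2 : Qp) ab.2].

Definition branch ab x : Qp := (ratr ab.1 + (ratr ab.2 + x)^-1)^-1.

Lemma branch_inj ab : injective (branch ab).
Proof. by move=> x y /invr_inj/addrI/invr_inj/addrI. Qed.

Lemma digit_pair_pval ab : digit_pair ab -> exists m n : nat,
  pval (ratr ab.1 : Qp) (- (m.+1)%:Z) /\ pval (ratr ab.2 : Qp) (- n%:Z).
Proof.
move=> [a0 b0 aa bb].
have [i i0 ai] := pval_ltP (is_floor_neq0 a0 aa).
have [j j0 bj] := pval_ltP (is_floor_neq0 b0 bb).
exists `|i|%N.-1, `|j|%N.
have -> : - (`|i|%N.-1.+1)%:Z = i by lia.
by have -> : - `|j|%N%:Z = j by lia.
Qed.

(** The exponents come from [v(a) = -(m+1)] and [v(b) = -n] and are chosen before [x], so that one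
    branch scales all balls alike. A ball is followed through two translations and two
    inversions. *)
Lemma branch_pval ab : digit_pair ab -> exists m n : nat,
  forall x, pZp x ->
  [/\ pval (ratr ab.2 + x)^-1 n%:Z, pval (branch ab x) m.+1%:Z &
  forall k : nat, (0 < k)%N ->
  [set branch ab y | y in padic_ball x k] =
    padic_ball (branch ab x) (k + (2 * m.+1 + 2 * n))%N].
Proof.
move=> /digit_pair_pval[m [n [am bn]]]; exists m, n => x /pZpE x1.
have bx : pval (ratr ab.2 + x) (- n%:Z) by apply: pvalD x1 => //; lia.
have un : pval (ratr ab.2 + x)^-1 n%:Z by rewrite -[n%:Z]opprK; exact: pvalV.
have au : pval (ratr ab.1 + (ratr ab.2 + x)^-1) (- m.+1%:Z).
  by apply: pvalD (pval_pideal un) => //; lia.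
split=> [//||k k0]; first by rewrite -[m.+1%:Z]opprK; exact: pvalV.
have -> : [set branch ab y | y in padic_ball x k] =
    [set y^-1 | y in [set ratr ab.1 + y | y in
    [set y^-1 | y in [set ratr ab.2 + y | y in padic_ball x k]]]].
  by rewrite !image_comp.
(* [0 < k] keeps the ball around [ratr ab.2 + x] away from [0] even when [n = 0]. *)
rewrite padic_ball_add (padic_ball_inv _ bx); last by lia.
rewrite padic_ball_add (padic_ball_inv _ au); last by lia.
by congr padic_ball; lia.
Qed.

Lemma branch_pZp ab x : digit_pair ab -> pZp x -> pZp (branch ab x).
Proof.
move=> abP xP; have [m [n /(_ _ xP)[_ fx _]]] := branch_pval abP.
by apply/pZpE; apply: pideal_le (pval_pideal fx); lia.
Qed.

Hypothesis p_odd : odd p.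

Lemma floor_s_pZp x : pZp x -> floor_s x = 0.
Proof.
move=> /pZpE x1; exact: is_floor_unique (floor_sP p_odd x) (is_floor0 x1).
Qed.

Lemma ratr0_padic : ratr 0 = 0 :> Qp.
Proof. by have := ratr_Zinvp p_pr 0 0; rewrite !mul0r. Qed.

Lemma complete_quotient1 x : pZp x ->
  complete_quotient x 1 = if x == 0 then None else Some x^-1.
Proof. by move=> xP; rewrite /= /floor_st /= floor_s_pZp // ratr0_padic subr0. Qed.

Lemma floor_t_branch ab x : digit_pair ab -> pZp x ->
  floor_t (branch ab x)^-1 = ab.1.
Proof.
move=> abP xP; have [m [n /(_ _ xP)[un _ _]]] := branch_pval abP.
have [_ _ aa _] := abP.
apply: is_floor_unique (floor_tP p_odd _) _; rewrite invrK.
by apply: is_floor_shift aa _; apply: pideal_le (pval_pideal un).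
Qed.

Lemma floor_s_shift ab x : digit_pair ab -> pZp x ->
  floor_s (ratr ab.2 + x) = ab.2.
Proof.
move=> [_ _ _ bb] /pZpE xP.
apply: is_floor_unique (floor_sP p_odd _) _.
exact: is_floor_shift bb xP.
Qed.

Lemma complete_quotient_branch1 ab x : digit_pair ab -> pZp x ->
  complete_quotient (branch ab x) 1 = Some (branch ab x)^-1.
Proof.
move=> abP xP; have [m [n /(_ _ xP)[_ fx _]]] := branch_pval abP.
by rewrite complete_quotient1 ?(negPf (pval_neq0 fx)) //; exact: branch_pZp.
Qed.

Lemma complete_quotient_branch2 ab x : digit_pair ab -> pZp x ->
  complete_quotient (branch ab x) 2 = Some (ratr ab.2 + x).
Proof.
move=> abP xP; have [m [n /(_ _ xP)[un fx _]]] := branch_pval abP.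
have := complete_quotient_branch1 abP xP.
rewrite [complete_quotient _ 2]/= => /= ->.
rewrite /floor_st /= floor_t_branch // [X in X == _]invrK [X in X - _]invrK.
by rewrite -subr_eq0 addrC addKr (negPf (pval_neq0 un)) invrK.
Qed.

(** The indices start at 3 and 1 because the quotient of index 2 is [b + x] and not [x]; both become
    [x] once their value of [s] is removed. A shift by two preserves the choice of floor. *)
Lemma complete_quotient_branch ab x n : digit_pair ab -> pZp x ->
  complete_quotient (branch ab x) n.+3 = complete_quotient x n.+1.
Proof.
move=> abP xP; elim: n => [|n IH].
  rewrite complete_quotient1 //.
  have := complete_quotient_branch2 abP xP.
  rewrite [complete_quotient _ 3]/= => /= ->.
  rewrite /floor_st /= floor_s_shift // -subr_eq0 addrC addKr.
  by [].
have -> : complete_quotient (branch ab x) n.+4 =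
  if complete_quotient (branch ab x) n.+3 is Some beta then
    let a := ratr (floor_st n.+3 beta) in
    if beta == a then None else Some (beta - a)^-1 else None by [].
by rewrite IH /floor_st /= negbK.
Qed.

Lemma partial_quotient_branch ab x n : digit_pair ab -> pZp x ->
  partial_quotient (branch ab x) n.+3 = partial_quotient x n.+1.
Proof.
move=> abP xP; rewrite /partial_quotient complete_quotient_branch //.
by rewrite /floor_st /= negbK.
Qed.

Lemma partial_quotient_branch1 ab x : digit_pair ab -> pZp x ->
  partial_quotient (branch ab x) 1 = Some ab.1.
Proof.
move=> abP xP; rewrite /partial_quotient complete_quotient_branch1 //=.
by rewrite /floor_st /= floor_t_branch.
Qed.

Lemma partial_quotient_branch2 ab x : digit_pair ab -> pZp x ->
  partial_quotient (branch ab x) 2 = Some ab.2.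
Proof.
move=> abP xP; rewrite /partial_quotient complete_quotient_branch2 //=.
by rewrite /floor_st /= floor_s_shift.
Qed.

(** The first two partial quotients recover the pair, and each branch is injective. *)
Lemma branch_disjoint ab ab' x x' : digit_pair ab -> digit_pair ab' ->
  pZp x -> pZp x' -> branch ab x = branch ab' x' -> ab = ab' /\ x = x'.
Proof.
move=> abP abP' xP xP' E.
have := partial_quotient_branch1 abP xP; rewrite E partial_quotient_branch1 //.
have := partial_quotient_branch2 abP xP; rewrite E partial_quotient_branch2 //.
move=> -[b_eq] [a_eq]; have abE : ab = ab'.
  by move: a_eq b_eq; case: (ab) (ab') => [? ?] [? ?] /= -> ->.
by split=> //; move: E; rewrite abE => /branch_inj.
Qed.

(** The hypotheses say that the algorithm stops neither at index 0 nor at index 1. Stopping at index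
    2 is allowed and corresponds to [x' = 0]. *)
Lemma branch_surj x : pZp x -> x != 0 -> x^-1 != ratr (floor_t x^-1) ->
  exists ab x', [/\ digit_pair ab, pZp x' & x = branch ab x'].
Proof.
move=> /pZpE xP x0.
set a := floor_t x^-1; have aP : is_floor 0 x^-1 a := floor_tP p_odd _.
rewrite -subr_eq0; set u := _ - _ => u0.
set b := floor_s u^-1; have bP : is_floor 1 u^-1 b := floor_sP p_odd _.
have aE : ratr a = x^-1 - u by rewrite opprB addrC subrK.
have bE : ratr b = u^-1 - (u^-1 - ratr b) by rewrite opprB addrC subrK.
have uP : pideal 0 u by case: aP.
have bP' : pideal 1 (u^-1 - ratr b) by case: bP.
(* A zero floor would put [w] in exponent [1 - e] and [w^-1] in exponent [e], although their
   valuations add up to 0. The case [e = 0] serves [a], the case [e = 1] serves [b]. *)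
have inv_neq0 (e : int) (w : Qp) (q : rat) : w != 0 -> pideal (1 - e) w ->
    ratr q = 0 :> Qp -> ~ pideal e (w^-1 - ratr q).
  move=> w0 wP ->; rewrite subr0 => wP'.
  have [n wn] := pval_ex w0.
  have := pval_le wn wP; have := pval_le (pvalV wn) wP'; lia.
exists (a, b), (u^-1 - ratr b); split; last 1 first.
- by rewrite /branch /= [ratr b + _]addrC subrK invrK [ratr a + _]addrC /u subrK invrK.
- split=> /=; [| |exact: is_floor_id aP|exact: is_floor_id bP].
  + by apply/eqP => a0; apply: (inv_neq0 0 x a x0 _ _ uP); rewrite ?a0 ?ratr0_padic.
  + by apply/eqP => b0; apply: (inv_neq0 1 u b u0 _ _ bP'); rewrite ?b0 ?ratr0_padic.
- exact/pZpE.
Qed.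

(** * Valuation of a rational number seen in [Q_p] *)

Lemma pval_nat (m : nat) : (0 < m)%N -> pval (m%:R : Qp) (logn p m).
Proof.
move=> m0; have [k kp mE] := pfactor_coprime p_pr m0.
exists (k%:R); last first.
  by rewrite {1}mE padic_of_int_natr natrM mulrC natrX.
apply: padic_unitE; rewrite padic_natrE expn1.
by rewrite -/(dvdn _ _) -prime_coprime.
Qed.

Lemma pval_int (m : int) : m != 0 -> pval (m%:~R : Qp) (logn p `|m|%N).
Proof.
move=> m0; have mP : pval (`|m|%N%:R : Qp) (logn p `|m|%N).
  by apply: pval_nat; rewrite absz_gt0.
have [m1|m1] := leP 0 m; first by rewrite -[X in X%:~R](gez0_abs m1).
rewrite -[m%:~R]opprK -mulrNz -(ltz0_abs m1) -pmulrn.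
case: mP => u uu ->; exists (- u); first by rewrite unitrN.
by rewrite padic_of_intN mulrN.
Qed.

Lemma pval_ratr (y : rat) (n : int) : padic_val p y = n%:E -> pval (ratr y : Qp) n.
Proof.
rewrite /padic_val; case: eqVneq => // y0 [<-].
rewrite /ratr; apply: pvalM; first by apply: pval_int; rewrite numq_eq0.
by apply: pvalV; apply: pval_int; exact: denq_neq0.
Qed.

End Dynamics.

(** * Haar measure *)

Section Haar.
Variables (R : realType) (p : nat) (p_pr : prime p).
Variable mu : {measure set (borel_padic p_pr) -> \bar R}.
Hypothesis mu_haar : normalized_haar mu.
Local Notation Qp := (padic p_pr).
Local Notation pZp := (pZp p_pr).
Local Notation measurableQ A := (measurable (A : set (borel_padic p_pr))).

Let p0 : (p%:R : Qp) != 0.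
Proof. by rewrite padic_natr_eq0 -lt0n prime_gt0. Qed.

Lemma measurable_padic_ball (x : Qp) (n : nat) : measurableQ (padic_ball x n).
Proof.
have oB : padic_open (padic_ball x n).
  by move=> y xy; exists n; rewrite (padic_ball_eq xy).
exact: sub_sigma_algebra oB.
Qed.

Lemma haar_ball_center (x : Qp) (n : nat) :
  mu (padic_ball x n) = mu (padic_ball 0 n).
Proof.
have [inv _ _] := mu_haar.
rewrite -(inv x (padic_ball 0 n)); last exact: measurable_padic_ball.
by rewrite padic_ball_add addr0.
Qed.

Lemma padic_ball_digits (n : nat) : padic_ball (0 : Qp) n =
  \big[setU/set0]_(i < p) padic_ball (i%:R * p%:R ^ n : Qp) n.+1.
Proof.
rewrite -(bigcup_mkord p (fun i => padic_ball (i%:R * p%:R ^ n : Qp) n.+1)).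
apply/seteqP; split=> x.
  move=> /padic_ballE; rewrite subr0 => -[z _ <-].
  have [t zt] := padic_congr z 1.
  exists (z 1%N) => /=; first by have := padic_res_lt z 1; rewrite expn1.
  apply/padic_ballE; rewrite {1}zt padic_of_intD padic_of_int_natr.
  rewrite mulrDr [X in X + _ - _]mulrC addrAC subrr add0r expr1.
  rewrite padic_of_intM padic_of_int_natr mulrA -exprnP -exprSr.
  by exists t.
move=> [i _ /padic_ballE xi]; apply/padic_ballE; rewrite subr0.
rewrite -(subrK (i%:R * p%:R ^ n) x); apply: pidealD.
  by apply: pideal_le xi; lia.
rewrite -[n%:Z]add0r; apply: pidealM; last exact: pideal_exp.
exact: (pideal_int p_pr i).
Qed.

Lemma padic_ball_digits_disjoint (n : nat) : trivIset [set: 'I_p]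
  (fun i : 'I_p => padic_ball (i%:R * p%:R ^ n : Qp) n.+1).
Proof.
move=> i j _ _ [x [/padic_ballE xi /padic_ballE xj]].
have := pidealB xi xj.
rewrite opprB addrC addrA subrK -mulrBl => ij.
have : pideal 1 ((j%:Z - i%:Z)%:~R : Qp).
  have -> : (1 : int) = n.+1%:Z - n%:Z by lia.
  have := pidealM ij (pideal_exp p_pr (- n%:Z)).
  by rewrite rmorphB /= -mulrA -expfzDr // subrr expr0z mulr1.
move=> /(@pideal_nat_dvd p p_pr 1); rewrite expn1 => ij'.
apply/val_inj => /=; have := ltn_ord i; have := ltn_ord j.
case: (ltngtP i j) => // lij jp ip; move: ij'.
  have -> : `|j%:Z - i%:Z|%N = (j - i)%N by lia.
  by rewrite gtnNdvd //; lia.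
have -> : `|j%:Z - i%:Z|%N = (i - j)%N by lia.
by rewrite gtnNdvd //; lia.
Qed.

(** The [p] subballs selected by the next digit are disjoint translates of one another and share the
    mass equally. The induction starts at [pZp], the ball of exponent 1, hence the shift between
    [n.+1] and [n]. *)
Lemma haar_ball (x : Qp) (n : nat) :
  mu (padic_ball x n.+1) = (p%:R^-1 ^+ n)%:E.
Proof.
elim: n x => [|n IH] x; first by have [_ _] := mu_haar; rewrite haar_ball_center.
rewrite haar_ball_center; have := IH 0.
rewrite padic_ball_digits measure_bigsetU_ord //; last 2 first.
- by move=> i; exact: measurable_padic_ball.
- exact: padic_ball_digits_disjoint.
rewrite (eq_bigr (fun=> mu (padic_ball (0 : Qp) n.+2))); last first.
  by move=> i _; exact: haar_ball_center.
(* Finiteness allows the equation for the measure of the smaller ball to be solved in [R]. *)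
have fin : mu (padic_ball (0 : Qp) n.+2) \is a fin_num.
  have le : (mu (padic_ball (0%R : Qp) n.+2) <= (p%:R^-1 ^+ n)%:E)%E.
    rewrite -(IH 0); apply: le_measure; rewrite ?inE; [exact: measurable_padic_ball..|].
    exact: padic_ballS.
  by rewrite ge0_fin_numE //; exact: le_lt_trans le (ltry _).
rewrite -(fineK fin) sumEFin sumr_const card_ord => -[E].
congr EFin; rewrite exprS -E -[X in _ * X]mulr_natl mulrA mulVf ?mul1r //.
by rewrite pnatr_eq0 -lt0n prime_gt0.
Qed.

Lemma padic_set1E (x : Qp) : [set x] = \bigcap_(n in [set: nat]) padic_ball x n.+1.
Proof.
apply/seteqP; split=> [_ -> n _|y xy]; first exact: padic_ball_center.
apply/eqP; rewrite -subr_eq0; apply/negP => /negP /pval_ex[n yx].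
have /padic_ballE := xy `|n|%N I; move=> /(pval_le yx); lia.
Qed.

Lemma measurable_padic_set1 (x : Qp) : measurableQ [set x].
Proof.
rewrite padic_set1E; apply: bigcap_measurable; first by exists 0%N.
by move=> n _; exact: measurable_padic_ball.
Qed.

Lemma haar_set1 (x : Qp) : mu [set x] = 0%E.
Proof.
apply/eqP; rewrite eq_le measure_ge0 andbT.
have mx n : (mu [set x] <= (p%:R^-1 ^+ n)%:E)%E.
  rewrite -(haar_ball x n); apply: le_measure; rewrite ?inE.
  - exact: measurable_padic_set1.
  - exact: measurable_padic_ball.
  - by move=> _ ->; exact: padic_ball_center.
have fin : mu [set x] \is a fin_num.
  by rewrite ge0_fin_numE //; apply: le_lt_trans (mx 0%N) (ltry _).
rewrite -(fineK fin) lee_fin; apply/ler_addgt0Pr => e e0; rewrite add0r.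
have : (fun n => p%:R^-1 ^+ n) @ \oo --> (0 : R).
  apply: cvg_expr; rewrite ger0_norm ?invr_ge0 //.
  by rewrite invf_lt1 ?ltr0n ?ltr1n ?prime_gt0 ?prime_gt1.
move=> /cvgrPdist_le /(_ e e0) [n _ /(_ n (leqnn n))].
rewrite sub0r normrN ger0_norm ?exprn_ge0 ?invr_ge0 //.
by apply: le_trans; rewrite -lee_fin fineK.
Qed.

(** Indexing by [rat] suits the points where the algorithm stops at index 0 or 1: they are [0] and
    inverses of rational numbers. *)
Lemma haar_countable (f : rat -> Qp) (A : set Qp) :
  measurableQ A -> A `<=` range f -> mu A = 0%E.
Proof.
move=> mA Af; apply: measure_negligible => //.
have : mu.-negligible (\bigcup_n (if unpickle n is Some q then [set f q] else set0)).
  apply: negligible_bigcup => n; case: (unpickle n) => [q|]; last exact: negligible_set0.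
  by exists [set f q]; split=> //; [exact: measurable_padic_set1|exact: haar_set1].
apply: negligibleS => x /Af[q _ <-]; exists (pickle q); first exact: I.
by rewrite pickleK.
Qed.

(** Scaling by [p^-N], expressed on images of balls inside [pZp] because only the measure of these
    images matters; the condition is stable under composition. *)
Definition similarity (N : nat) (f : Qp -> Qp) :=
  [/\ set_inj pZp f, (forall x, pZp x -> pZp (f x)) &
    forall x (k : nat), pZp x ->
      [set f y | y in padic_ball x k.+1] = padic_ball (f x) (k.+1 + N)%N].

Lemma similarity_id : similarity 0 id.
Proof. by split=> // x k _; rewrite image_id addn0. Qed.

Lemma similarity_comp M N f g : similarity M f -> similarity N g ->
  similarity (N + M) (f \o g).
Proof.
move=> [f_inj fX fB] [g_inj gX gB]; split=> [x y|x /gX /fX //|x k xX].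
  rewrite !inE => xX yX /f_inj; rewrite !inE => /(_ (gX _ xX) (gX _ yX)).
  by apply: g_inj; rewrite inE.
have -> : [set (f \o g) y | y in padic_ball x k.+1] =
    [set f z | z in [set g y | y in padic_ball x k.+1]] by rewrite image_comp.
by rewrite (gB _ _ xX) addSn (fB _ _ (gX _ xX)) -addSn addnA.
Qed.

Hypothesis p_odd : odd p.

Lemma similarity_branch ab : digit_pair p_pr ab ->
  exists N, similarity N (branch (p_pr := p_pr) ab).
Proof.
move=> abP; have [m [n mnP]] := branch_pval abP.
exists (2 * m.+1 + 2 * n)%N; split.
- by move=> x y _ _ /branch_inj.
- by move=> x; exact: branch_pZp.
- by move=> x k xP; have [_ _ ->] := mnP _ xP.
Qed.

(* This class contains [pZp] and is closed under the inverse branches and under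
   countable disjoint unions, so it contains all the preimages of [pZp] under the
   iterated Gauss map: the action of a branch on [mu] is only needed on balls. *)
Definition uniform (B : set Qp) := B `<=` pZp /\
  forall N f, similarity N f -> measurableQ (f @` B) /\
    mu (f @` B) = ((p%:R^-1 ^+ N)%:E * mu B)%E.

Lemma uniform_measurable B : uniform B -> measurableQ B.
Proof. by move=> [_ /(_ _ _ similarity_id)[]]; rewrite image_id. Qed.

Lemma pZp_ball : pZp = padic_ball (0 : Qp) 1%N. Proof. by []. Qed.

Lemma haar_pZp : mu pZp = 1%E. Proof. by case: mu_haar. Qed.

Lemma uniform_pZp : uniform pZp.
Proof.
split=> // N f [_ _ fB].
have X0 : pZp 0 by apply/pZpE; exact: pideal0.
rewrite pZp_ball fB // -pZp_ball add1n haar_ball // haar_pZp mule1; split => //.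
exact: measurable_padic_ball.
Qed.

Lemma uniform_le1 B : uniform B -> (mu B <= 1)%E.
Proof.
move=> uB; rewrite -haar_pZp; apply: le_measure; rewrite ?inE.
- exact: uniform_measurable.
- exact: uniform_measurable uniform_pZp.
- by case: uB.
Qed.

Lemma uniform_fin B : uniform B -> mu B \is a fin_num.
Proof.
by move=> uB; rewrite ge0_fin_numE //; exact: le_lt_trans (uniform_le1 uB) (ltry _).
Qed.

(** Exponents of similarities add under composition; the quantification over all similarities in
    [uniform] is what makes the class stable here. *)
Lemma uniform_image N f B : similarity N f -> uniform B -> uniform (f @` B).
Proof.
move=> fN [BX uB]; split=> [_ [x /BX xX <-]|M g gM]; first by case: fN => _ + _; apply.
have := uB _ _ (similarity_comp gM fN); rewrite -image_comp => -[mB ->].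
split=> //; have [_ ->] := uB _ _ fN.
by rewrite exprD mulrC EFinM muleA.
Qed.

Lemma uniform0 : uniform set0.
Proof.
split=> [|N f _]; first exact: sub0set.
by rewrite image_set0 measure0 mule0; split=> //; exact: measurable0.
Qed.

Lemma image_trivIset (f : Qp -> Qp) (F : nat -> set Qp) : set_inj pZp f ->
  (forall n, F n `<=` pZp) -> trivIset setT F ->
  trivIset setT (fun n => f @` F n).
Proof.
move=> f_inj FX tF i j _ _ [_ [[x Fx <-] [y Fy]]] /f_inj yx.
apply: tF => //; exists x; split=> //.
by rewrite -yx ?inE //; [exact: FX Fy|exact: FX Fx].
Qed.

Lemma uniform_bigcup (F : nat -> set Qp) : (forall n, uniform (F n)) ->
  trivIset setT F -> uniform (\bigcup_n F n).
Proof.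
move=> uF tF; split=> [x [n _ Fx]|N f fN]; first by have [+ _] := uF n; apply.
have mF n : measurableQ (F n) by exact: uniform_measurable.
have mfF n : measurableQ (f @` F n) by have [_ /(_ _ _ fN)[]] := uF n.
rewrite image_bigcup; split; first exact: bigcup_measurable.
rewrite !measure_bigcup //; last first.
  by apply: image_trivIset tF; [case: fN|move=> n; case: (uF n)].
rewrite -nneseriesZl //; apply: eq_eseriesr => n _.
by have [_ /(_ _ _ fN)[]] := uF n.
Qed.

(* [pullback P B] is the set of the points whose first pair of partial
   quotients satisfies [P] and whose image under the Gauss map lies in [B]. *)
Definition pullback_piece (P : pred (rat * rat)) (B : set Qp) (n : nat) : set Qp :=
  if @pickle_inv (rat * rat)%type n is Some ab then
    [set branch ab x | x in [set x | [/\ digit_pair p_pr ab, P ab & B x]]]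
  else set0.

Definition pullback P B := \bigcup_n pullback_piece P B n.

Lemma pullbackP P B x : pullback P B x <->
  exists ab x', [/\ digit_pair p_pr ab, P ab, B x' & x = branch ab x'].
Proof.
split=> [[n _]|[ab [x' [abP Pab Bx ->]]]].
  rewrite /pullback_piece; case: pickle_inv => // ab [x' [abP Pab Bx] <-].
  by exists ab, x'.
exists (pickle ab); first exact: I.
by rewrite /pullback_piece pickleK_inv; exists x'.
Qed.

Lemma pullback_piece_cases (P : pred (rat * rat)) n :
  (exists ab, [/\ digit_pair p_pr ab, P ab &
     forall C, pullback_piece P C n = branch ab @` C]) \/
  forall C, pullback_piece P C n = set0.
Proof.
rewrite /pullback_piece; case: pickle_inv => [ab|]; last by right.
have [[abP Pab]|nab] := pselect (digit_pair p_pr ab /\ P ab).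
  left; exists ab; split=> // C; congr image; apply/seteqP.
  by split=> x // [].
by right=> C; rewrite -subset0 => z [x [abP Pab _] _]; case: nab.
Qed.

Lemma uniform_pullback_piece P B n : uniform B -> uniform (pullback_piece P B n).
Proof.
move=> uB; have [[ab [abP _ ->]]|->] := pullback_piece_cases P n.
  by have [N fN] := similarity_branch abP; exact: uniform_image fN uB.
exact: uniform0.
Qed.

(** The scaling factor depends on the branch and not on [B]; taking [pZp], of mass 1, in place of
    [B] identifies it. *)
Lemma haar_pullback_piece P B n : uniform B ->
  mu (pullback_piece P B n) = (mu (pullback_piece P pZp n) * mu B)%E.
Proof.
move=> uB; have [[ab [abP _ E]]|E] := pullback_piece_cases P n; rewrite !E.
  have [N fN] := similarity_branch abP.
  have [_ /(_ _ _ fN)[_ ->]] := uB.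
  by have [_ /(_ _ _ fN)[_ ->]] := uniform_pZp; rewrite haar_pZp mule1.
by rewrite measure0 mul0e.
Qed.

Lemma trivIset_pullback P B : B `<=` pZp -> trivIset setT (pullback_piece P B).
Proof.
move=> BX n m _ _ [x []]; rewrite /pullback_piece.
have := @pickle_invK (rat * rat)%type n; have := @pickle_invK (rat * rat)%type m.
case: (pickle_inv m) => [ab'|//] /= <-; case: (pickle_inv n) => [ab|//] /= <-.
move=> [y [abP _ /BX yX] <-] [z [abP' _ /BX zX] E].
by have [->] := branch_disjoint p_odd abP' abP zX yX E.
Qed.

Lemma uniform_pullback P B : uniform B -> uniform (pullback P B).
Proof.
move=> uB; apply: uniform_bigcup => [n|]; first exact: uniform_pullback_piece.
by apply: trivIset_pullback; case: uB.
Qed.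

(** Summed over the branches, this is the independence of the first pair of partial quotients from
    everything that follows. *)
Lemma haar_pullback P B : uniform B ->
  mu (pullback P B) = (mu (pullback P pZp) * mu B)%E.
Proof.
move=> uB.
have mP C n : uniform C -> measurableQ (pullback_piece P C n).
  by move=> uC; apply: uniform_measurable; exact: uniform_pullback_piece.
rewrite !measure_bigcup => [|n _|||]; last 4 first.
- by apply: mP; exact: uniform_pZp.
- exact: trivIset_pullback.
- by move=> n _; exact: mP.
- by apply: trivIset_pullback; case: uB.
rewrite muleC -(fineK (uniform_fin uB)) -nneseriesZl //.
apply: eq_eseriesr => n _.
by rewrite haar_pullback_piece // fineK ?uniform_fin // muleC.
Qed.

Lemma pullback_sub P B : B `<=` pZp -> pullback P B `<=` pZp.
Proof.
by move=> BX x /pullbackP[ab [x' [abP _ /BX Bx' ->]]]; exact: branch_pZp.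
Qed.

(** By [branch_surj], the points of [pZp] on no branch are [0] and those where the algorithm stops
    at index 1. *)
Lemma haar_pullback_pZp : mu (pullback xpredT pZp) = 1%E.
Proof.
set U := pullback _ _.
have UX : U `<=` pZp by exact: pullback_sub.
have mU : measurableQ U.
  by apply: uniform_measurable; apply: uniform_pullback; exact: uniform_pZp.
have mX : measurableQ pZp := uniform_measurable uniform_pZp.
have : mu pZp = (mu (pZp `\` U) + mu (pZp `&` U))%E := measureDI mu mX mU.
rewrite haar_pZp (@haar_countable (fun q => (ratr q)^-1) (pZp `\` U)).
- by rewrite add0e (setIidr UX).
- exact: measurableD.
move=> x [xX nUx]; have [->|x0] := eqVneq x 0.
  (* [q = 0] covers the point [0], by the convention [0^-1 = 0]. *)
  by exists 0 => //; rewrite ratr0_padic invr0.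
have [xE|xE] := eqVneq x^-1 (ratr (floor_t x^-1)).
  by exists (floor_t x^-1) => //; rewrite -xE invrK.
have [ab [x' [abP x'X E]]] := branch_surj p_odd xX x0 xE.
by case: nUx; apply/pullbackP; exists ab, x'.
Qed.

(** * The events [a_(2n+1) = y] and their pairwise independence *)

Section Digit.
Variables (y : rat) (k : nat).
Hypotheses (y_floor : is_floor 0 (ratr y : Qp) y)
  (yk : pval (ratr y : Qp) (- k.+1%:Z)).

(** [a_1 = y] means that [x^-1] lies in [y + Z_p]; inverting this ball, where [v(y) = -(k+1)], gives
    the exponent [2(k+1)]. At the centre [x^-1 = y] the algorithm stops, so that point is on no
    branch. *)
Lemma pullback_digitE : pullback (fun ab => ab.1 == y) pZp =
  padic_ball (ratr y)^-1 (2 * k).+2 `\` [set (ratr y)^-1].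
Proof.
apply/seteqP; split=> x.
  move=> /pullbackP[ab [x' [abP /eqP aby x'X ->]]].
  have [m [n /(_ _ x'X)[un _ _]]] := branch_pval abP.
  rewrite /branch aby; split; last first.
    move=> /= /invr_inj /eqP; rewrite -subr_eq0 addrC addKr.
    by rewrite (negPf (pval_neq0 un)).
  have -> : (2 * k).+2%:Z = 0 - 2 * (- k.+1%:Z) by lia.
  apply: padic_ball_inv_sub yk _ _; first by lia.
  apply/padic_ballE; rewrite addrC addKr.
  by apply: pideal_le (pval_pideal un).
move=> [xB xy].
have yVk : pval (ratr y : Qp)^-1 k.+1%:Z by rewrite -[k.+1%:Z]opprK; exact: pvalV.
have xk : pval x k.+1%:Z.
  rewrite -[x](subrK (ratr y)^-1) addrC.
  by move/padic_ballE : xB => xB; apply: pvalD xB => //; lia.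
have xX : pZp x by apply/pZpE; apply: pideal_le (pval_pideal xk); lia.
have xV : pideal 0 (x^-1 - ratr y).
  apply/padic_ballE; have -> : (0 : int) = (2 * k).+2%:Z - 2 * k.+1%:Z by lia.
  rewrite -[X in padic_ball X]invrK; apply: padic_ball_inv_sub yVk _ xB; lia.
have xy_floor : floor_t x^-1 = y.
  apply: is_floor_unique (floor_tP p_odd _) _.
  by rewrite -(subrK (ratr y) x^-1) addrC; exact: is_floor_shift y_floor xV.
have [|ab [x' [abP x'X E]]] := branch_surj p_odd xX (pval_neq0 xk).
  by rewrite xy_floor; apply: contra_not_neq xy => <-; rewrite invrK.
apply/pullbackP; exists ab, x'; split=> //.
by rewrite -(floor_t_branch p_odd abP x'X) -E xy_floor.
Qed.

Lemma haar_pullback_digit :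
  mu (pullback (fun ab => ab.1 == y) pZp) = (p%:R^-1 ^+ (2 * k).+1)%:E.
Proof.
rewrite pullback_digitE.
have mB := measurable_padic_ball (ratr y)^-1 (2 * k).+2.
have m1 := measurable_padic_set1 (ratr y)^-1.
rewrite -(haar_ball (ratr y)^-1) (measureDI mu mB m1).
rewrite [X in (_ + X)%E](_ : _ = 0%E) ?adde0 //.
rewrite setIidr; first exact: haar_set1.
by move=> _ ->; exact: padic_ball_center.
Qed.

(* [digit_event n] is [a_(2n+1) = y] up to the null set outside [domain n.+1]. *)
Definition domain n := iter n (pullback xpredT) pZp.
Definition digit_event n :=
  iter n (pullback xpredT) (pullback (fun ab => ab.1 == y) pZp).

Lemma uniform_iter B n : uniform B -> uniform (iter n (pullback xpredT) B).
Proof. by move=> uB; elim: n => //= n IH; exact: uniform_pullback. Qed.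

(** Invariance of [mu] under the Gauss map: [haar_pullback] with the factor [haar_pullback_pZp]. *)
Lemma haar_iter B n : uniform B -> mu (iter n (pullback xpredT) B) = mu B.
Proof.
move=> uB; elim: n => //= n IH; rewrite haar_pullback ?haar_pullback_pZp ?mul1e //.
exact: uniform_iter.
Qed.

Lemma uniform_digit_event n : uniform (digit_event n).
Proof. by apply/uniform_iter/uniform_pullback/uniform_pZp. Qed.

Lemma haar_domain n : mu (domain n) = 1%E.
Proof. by rewrite haar_iter ?haar_pZp //; exact: uniform_pZp. Qed.

Lemma haar_digit_event n : mu (digit_event n) = (p%:R^-1 ^+ (2 * k).+1)%:E.
Proof.
by rewrite haar_iter ?haar_pullback_digit //; apply/uniform_pullback/uniform_pZp.
Qed.

Lemma pullbackI P Q B C : B `<=` pZp -> C `<=` pZp ->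
  pullback P B `&` pullback Q C = pullback (fun ab => P ab && Q ab) (B `&` C).
Proof.
move=> BX CX; apply/seteqP; split=> x.
  move=> [/pullbackP[ab [z [abP Pab Bz ->]]] /pullbackP[ab' [z' [abP' Qab' Cz' E]]]].
  have [abE zE] := branch_disjoint p_odd abP abP' (BX _ Bz) (CX _ Cz') E.
  apply/pullbackP; exists ab, z; split=> //; first by rewrite /= Pab abE.
  by split; rewrite // zE.
move=> /pullbackP[ab [z [abP /andP[Pab Qab] [Bz Cz] ->]]].
by split; apply/pullbackP; exists ab, z.
Qed.

Lemma iter_pullbackI B C n : B `<=` pZp -> C `<=` pZp ->
  iter n (pullback xpredT) B `&` iter n (pullback xpredT) C =
  iter n (pullback xpredT) (B `&` C).
Proof.
move=> BX CX; elim: n => //= n IH.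
have sub A m : A `<=` pZp -> iter m (pullback xpredT) A `<=` pZp.
  by move=> AX; elim: m => //= m IHm; exact: pullback_sub.
by rewrite pullbackI ?IH //; exact: sub.
Qed.

(** Invariance removes the [i] common pullbacks. What remains is a condition on the first pair
    together with a pullback of [B], and [haar_pullback] multiplies the two measures. *)
Lemma haar_digit_event_lt i j : (i < j)%N ->
  mu (digit_event i `&` digit_event j) =
  ((p%:R^-1 ^+ (2 * k).+1) ^+ 2)%:E.
Proof.
move=> /subnKC <-; rewrite addSnnS /digit_event iterD iterS.
pose Py := fun ab : rat * rat => ab.1 == y; rewrite -/Py; set B := iter (j - i.+1) _ _.
have uB : uniform B := uniform_digit_event _.
have uX := uniform_pZp.
have EX : pullback Py pZp `<=` pZp by exact: pullback_sub.
have BX : B `<=` pZp by case: uB.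
rewrite iter_pullbackI //; last exact: pullback_sub.
rewrite pullbackI // (setIidr BX).
rewrite haar_iter; last exact: uniform_pullback.
rewrite haar_pullback // (_ : (fun ab => Py ab && true) = Py); last first.
  by apply/funext => ab; rewrite andbT.
by rewrite haar_pullback_digit haar_digit_event -EFinM.
Qed.

Lemma haar_digit_eventI i j : i != j ->
  mu (digit_event i `&` digit_event j) =
  ((p%:R^-1 ^+ (2 * k).+1) ^+ 2)%:E.
Proof.
by case: ltngtP => // ij _; [|rewrite setIC]; exact: haar_digit_event_lt.
Qed.

Lemma digit_event_partial_quotient n x : digit_event n x ->
  partial_quotient x (2 * n).+1 = Some y.
Proof.
elim: n x => [|n IH] x /pullbackP[ab [z [abP Pab zP ->]]].
  by rewrite partial_quotient_branch1 // (eqP Pab).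
have zX : pZp z by have [+ _] := uniform_digit_event n; apply.
by rewrite mulnS partial_quotient_branch //; exact: IH.
Qed.

(** [domain n.+1] excludes the points where the algorithm stops exactly at the value [y]: they have
    this partial quotient but lie outside the event. *)
Lemma partial_quotient_digit_event n x : domain n.+1 x ->
  partial_quotient x (2 * n).+1 = Some y -> digit_event n x.
Proof.
elim: n x => [|n IH] x /pullbackP[ab [z [abP _ zP ->]]].
  rewrite partial_quotient_branch1 // => -[aby].
  by apply/pullbackP; exists ab, z; rewrite aby.
have zX : pZp z by have [+ _] := uniform_iter n.+1 uniform_pZp; apply.
rewrite mulnS partial_quotient_branch // => /(IH _ zP) Ez.
by apply/pullbackP; exists ab, z.
Qed.

Lemma ae_domain : {ae mu, forall x, pZp x -> forall n, domain n x}.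
Proof.
have mX : measurableQ pZp := uniform_measurable uniform_pZp.
suff : {ae mu, forall x n, pZp x -> domain n x}.
  apply: (@filterS _ _ (ae_filter_ringOfSetsType mu)) => x xD xX n.
  exact: xD.
apply: ae_foralln => n.
have uD : uniform (domain n) by apply: uniform_iter; exact: uniform_pZp.
have mD := uniform_measurable uD.
have DX : domain n `<=` pZp by case: uD.
exists (pZp `\` domain n); split.
- exact: measurableD.
- have : mu pZp = (mu (pZp `\` domain n) + mu (pZp `&` domain n))%E :=
    measureDI mu mX mD.
  rewrite haar_pZp (setIidr DX) haar_domain.
  case: (mu _) => // r; rewrite -EFinD => -[r1].
  by have -> : r = 0 by lra.
- move=> x /= nD; apply: contrapT => nXD; apply: nD => xX.
  by apply: contrapT => nDx; apply: nXD.
Qed.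

Lemma odd_frequencyE x n : (forall m, domain m x) ->
  odd_frequency R x y n = (\sum_(i < n) \1_(digit_event i) x) / n%:R.
Proof.
move=> xD; rewrite /odd_frequency -sum1_card natr_sum big_mkcond /=.
congr (_ / _); apply: eq_bigr => i _; rewrite inE addn1 indicE.
case: eqP => [xy|xy].
  by rewrite mem_set //; exact: partial_quotient_digit_event (xD _) xy.
by rewrite memNset // => /digit_event_partial_quotient.
Qed.

End Digit.

End Haar.

(** * A strong law of large numbers *)

Lemma sqrtn_ex (n : nat) : exists s : nat, (s ^ 2 <= n < s.+1 ^ 2)%N.
Proof.
elim: n => [|n [s /andP[sn ns]]]; first by exists 0%N.
have [|] := ltnP n.+1 (s.+1 ^ 2)%N; first by exists s; lia.
by exists s.+1; nia.
Qed.

(* A 1-Lipschitz sequence that is [o(n)] along the squares is [o(n)], because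
   consecutive squares are [O(sqrt n)] apart. *)
Lemma lipschitz_cvg_squares (R : realType) (u : nat -> R) :
  (forall m n : nat, (m <= n)%N -> `|u n - u m| <= (n - m)%N%:R) ->
  (fun m => u (m.+1 ^ 2)%N / (m.+1 ^ 2)%N%:R) @ \oo --> (0 : R) ->
  (fun n => u n / n%:R) @ \oo --> (0 : R).
Proof.
move=> u_lip u0; apply/cvgrPdist_le => e e0.
(* One third bounds [u] at the preceding square; two thirds absorb the gap to [n], which is at most
   twice the integer square root. [K] makes that root at least [(e / 3)^-1]. *)
have e3 : 0 < e / 3 by rewrite divr_gt0.
have [N _ NP] := (cvgrPdist_le _ _).1 u0 _ e3.
have [K Ke] : exists K : nat, (e / 3)^-1 <= K%:R.
  by exists (Num.bound (e / 3)^-1); apply/ltW/archi_boundP; rewrite invr_ge0 ltW.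
exists ((maxn N.+1 K.+1) ^ 2)%N => // n /= Mn.
have [s /andP[sn ns]] := sqrtn_ex n.
have sM : (maxn N.+1 K.+1 <= s)%N.
  by rewrite -ltnS -(ltn_exp2r _ _ (ltn0Sn 1)); exact: leq_ltn_trans Mn ns.
have sN : (N < s)%N by apply: leq_trans sM; exact: leq_maxl.
have sK : (K < s)%N by apply: leq_trans sM; exact: leq_maxr.
case: s => // s in sn ns sM sN sK *.
have := NP s sN; rewrite !sub0r !normrN !normrM !normfV.
have n0 : (0 < n)%N by nia.
have s20 : 0 < (s.+1 ^ 2)%N%:R :> R by rewrite ltr0n expn_gt0.
rewrite !(ger0_norm (ler0n _ _)) !ler_pdivrMr ?ltr0n // => us.
have := u_lip _ _ sn => un.
have un' : `|u n| <= `|u (s.+1 ^ 2)%N| + (n - s.+1 ^ 2)%N%:R.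
  rewrite -[u n](subrK (u (s.+1 ^ 2)%N)) addrC.
  by apply: le_trans (ler_normD _ _) _; rewrite lerD2l.
apply: (le_trans un').
have h1 : (n - s.+1 ^ 2)%N%:R <= 2 * s.+1%:R :> R.
  rewrite -natrM ler_nat; nia.
have h2 : s.+1%:R <= e / 3 * (s.+1 ^ 2)%N%:R.
  rewrite natrX expr2 mulrA ler_peMl //.
  rewrite -ler_pdivrMl // mulr1; apply: le_trans Ke _.
  by rewrite ler_nat ltnW.
have h3 : (s.+1 ^ 2)%N%:R <= n%:R :> R by rewrite ler_nat.
have h4 : e / 3 * (s.+1 ^ 2)%N%:R <= e / 3 * n%:R by rewrite ler_pM2l.
lra.
Qed.

(** Telescoping: [1 / a^2 <= 2 / (a (a + 1)) = 2 / a - 2 / (a + 1)] for [a >= 1]. *)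
Lemma sum_inv_sqr_le (R : realFieldType) (n : nat) :
  \sum_(0 <= m < n) ((m.+1 ^ 2)%N%:R)^-1 <= 2 - 2 / n.+1%:R :> R.
Proof.
elim: n => [|n IH]; first by rewrite big_geq // divr1 subrr.
rewrite big_nat_recr //=; apply: le_trans (lerD IH (lexx _)) _.
rewrite natrX -[n.+2%:R]natr1; set a : R := n.+1%:R.
have a1 : 1 <= a by rewrite /a ler1n.
have -> : 2 - 2 / (a + 1) = 2 - 2 / a + 2 / (a * (a + 1)).
  by field; apply/andP; split; lra.
have a0 : 0 < a by lra.
rewrite lerD2l -div1r ler_pdivrMr ?exprn_gt0 //.
by rewrite mulrAC ler_pdivlMr ?mulr_gt0 //; nra.
Qed.

Section SLLN.
Variables (d : measure_display) (T : measurableType d) (R : realType).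
Variables (mu : {measure set T -> \bar R}) (X : set T) (E : nat -> set T) (q : R).
Hypotheses (mX : measurable X) (muX : mu X = 1%E)
  (mE : forall i, measurable (E i)) (EX : forall i, E i `<=` X)
  (muE : forall i, mu (E i) = q%:E)
  (muEI : forall i j, i != j -> mu (E i `&` E j) = (q ^+ 2)%:E).

Let S (n : nat) (x : T) : R := \sum_(i < n) \1_(E i) x.

Let q_ge0 : 0 <= q. Proof. by rewrite -lee_fin -(muE 0) measure_ge0. Qed.

Let q_le1 : q <= 1.
Proof. by rewrite -lee_fin -(muE 0) -muX; apply: le_measure; rewrite ?inE. Qed.

Let S_ge0 n x : 0 <= S n x.
Proof. by apply: sumr_ge0 => i _; rewrite indicE. Qed.

Let mS n : measurable_fun X (S n).
Proof. by apply: measurable_sum => i; exact: measurable_indic. Qed.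

Let int_S n : (\int[mu]_(x in X) (S n x)%:E = (n%:R * q)%:E)%E.
Proof.
under eq_integral do rewrite -sumEFin.
rewrite ge0_integral_sum //.
- rewrite (eq_bigr (fun=> q%:E)) => [|i _].
    by rewrite sumEFin sumr_const card_ord -[X in X%:E]mulr_natl.
  by rewrite integral_indic // setIidl.
- by move=> i; apply/measurable_EFinP; exact: measurable_indic.
Qed.

Let int_S2 n : (\int[mu]_(x in X) (S n x ^+ 2)%:E =
  (n%:R * (q + (n%:R - 1) * q ^+ 2))%:E)%E.
Proof.
have S2E x : ((S n x ^+ 2)%:E =
    \sum_(i < n) \sum_(j < n) (\1_(E i `&` E j) x)%:E :> \bar R)%E.
  rewrite expr2 /S mulr_suml -sumEFin; apply: eq_bigr => i _.
  by rewrite mulr_sumr -sumEFin; apply: eq_bigr => j _; rewrite indicI.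
under eq_integral do rewrite S2E.
have mI i j : measurable (E i `&` E j) by exact: measurableI.
have mf i j : measurable_fun X (fun x => (\1_(E i `&` E j) x)%:E : \bar R).
  by apply/measurable_EFinP; exact: measurable_indic.
rewrite ge0_integral_sum //; last 2 first.
- by move=> i; apply: emeasurable_sum => j.
- by move=> i x _; apply: sume_ge0 => j _; rewrite lee_fin indicE.
rewrite (eq_bigr (fun i : 'I_n => (q + (n%:R - 1) * q ^+ 2)%:E)) => [|i _].
  by rewrite sumEFin sumr_const card_ord -[X in X%:E]mulr_natl.
rewrite ge0_integral_sum //.
(* A diagonal term gives [q], any other gives [q ^+ 2]: pairwise independence enters here. *)
rewrite (eq_bigr (fun j : 'I_n => (q ^+ 2 + if j == i then q - q ^+ 2 else 0)%:E)).
  rewrite sumEFin big_split /= sumr_const card_ord -big_mkcond big_pred1_eq.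
  by congr EFin; rewrite -[X in X + _]mulr_natl; ring.
move=> j _; rewrite integral_indic // setIidl; last by move=> x [/EX].
case: (eqVneq j i) => [->|ji]; first by rewrite setIid muE addrC subrK.
by rewrite addr0 muEI // eq_sym.
Qed.

Let mdev n : measurable_fun X (fun x => (S n x - n%:R * q) ^+ 2).
Proof. by apply: measurable_funX; apply: measurable_funB. Qed.

(** The square is expanded with the cross term moved to the other side, so that only nonnegative
    functions are integrated; the subtraction takes place in [R]. *)
Let int_dev n : (\int[mu]_(x in X) ((S n x - n%:R * q) ^+ 2)%:E =
  (n%:R * (q - q ^+ 2))%:E)%E.
Proof.
have c0 : 0 <= 2 * (n%:R * q) by rewrite !mulr_ge0.
have key : (\int[mu]_(x in X) ((S n x - n%:R * q) ^+ 2)%:E +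
    (2 * (n%:R * q))%:E * (n%:R * q)%:E =
    (n%:R * (q + (n%:R - 1) * q ^+ 2))%:E + ((n%:R * q) ^+ 2)%:E)%E.
  rewrite -[in (_ * _)%E]int_S -int_S2 -ge0_integralZl_EFin //; last 2 first.
  - by move=> x _; rewrite lee_fin.
  - exact/measurable_EFinP.
  rewrite -[X in (_ = _ + X)%E]mule1 -muX -integral_cst //.
  rewrite -!ge0_integralD //.
  - by apply: eq_integral => x _; rewrite /= -EFinM -!EFinD; congr EFin; ring.
  - by move=> x _; rewrite lee_fin sqr_ge0.
  - by apply/measurable_EFinP; exact: measurable_funX.
  - by move=> x _ /=; rewrite lee_fin sqr_ge0.
  - by move=> x _; rewrite lee_fin sqr_ge0.
  - by apply/measurable_EFinP.
  - by move=> x _; rewrite -EFinM lee_fin mulr_ge0.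
  - by apply/measurable_EFinP; exact: measurable_funM.
move: key; case: (integral _ _ _) => // r.
by rewrite -EFinM -!EFinD => -[] h; congr EFin; move: h; nra.
Qed.

(** Along [n = (m+1)^2] the squared normalized deviations have summable integrals, so their sum [h]
    is finite almost everywhere and its terms tend to 0. The Lipschitz bound controls what happens
    between squares. Integrals are over [X], of mass 1, as [mu] may be infinite on [T]. *)
Lemma pairwise_independent_frequency :
  {ae mu, forall x, X x -> (fun n => S n x / n%:R) @ \oo --> q}.
Proof.
pose g m x := (((S (m.+1 ^ 2) x - (m.+1 ^ 2)%N%:R * q) / (m.+1 ^ 2)%N%:R) ^+ 2).
have g0 m x : 0 <= g m x by exact: sqr_ge0.
have mg m : measurable_fun X (EFin \o g m).
  apply/measurable_EFinP; apply: measurable_funX; apply: measurable_funM => //.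
  exact: measurable_funB.
have int_g m : (\int[mu]_(x in X) (g m x)%:E <= ((m.+1 ^ 2)%N%:R^-1)%:E)%E.
  set M := (m.+1 ^ 2)%N; have M0 : 0 < M%:R :> R by rewrite ltr0n expn_gt0.
  rewrite (eq_integral (fun x =>
      (M%:R ^- 2)%:E * ((S M x - M%:R * q) ^+ 2)%:E)%E); last first.
    by move=> x _; rewrite /g -EFinM exprMn mulrC -exprVn.
  rewrite ge0_integralZl_EFin //; last 2 first.
  - by move=> x _; rewrite lee_fin sqr_ge0.
  - exact/measurable_EFinP.
  (* The variance [M (q - q^2)] divided by [M^2] is at most [1 / M], which is summable in [m] since
     [M] is a square. *)
  rewrite int_dev -EFinM lee_fin expr2 invfM -mulrA mulKf ?gt_eqF //.
  by rewrite ler_piMr ?invr_ge0 ?ltW //; nra.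
pose h x := (\sum_(0 <= m <oo) (g m x)%:E)%E.
have mh : measurable_fun X h.
  apply: (@ge0_emeasurable_sum _ _ _ X (fun m x => (g m x)%:E) xpredT) => [m x _ _|m _].
    by rewrite lee_fin.
  exact: mg.
have int_h : mu.-integrable X h.
  apply/integrableP; split => //.
  rewrite (eq_integral h); last first.
    by move=> x _; rewrite gee0_abs //; apply: nneseries_ge0 => m _ _; rewrite lee_fin.
  rewrite integral_nneseries //; last by move=> m x _; rewrite lee_fin.
  apply: le_lt_trans (ltry 2); apply: lime_le.
    by apply: is_cvg_nneseries => m _ _; apply: integral_ge0 => x _; rewrite lee_fin.
  apply: nearW => n; apply: le_trans (lee_sum _ (fun i _ => int_g i)) _.
  rewrite sumEFin lee_fin; apply: le_trans (sum_inv_sqr_le _ _) _.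
  by rewrite gerBl divr_ge0.
apply: filterS (integrable_ae mX int_h) => x hx Xx.
have hfin := hx Xx.
have cvg_g : cvgn (series (fun m => g m x)).
  apply: nondecreasing_is_cvgn.
    by apply/nondecreasing_seqP => n; rewrite /series /= big_nat_recr //= lerDl.
  exists (fine (h x)) => _ [n _ <-].
  rewrite -lee_fin fineK // /series /= -sumEFin.
  by apply: nneseries_lim_ge => m _ _; rewrite lee_fin.
have g_cvg := cvg_series_cvg_0 cvg_g.
pose u n := S n x - n%:R * q.
have u_lip (m n : nat) : (m <= n)%N -> `|u n - u m| <= (n - m)%N%:R.
  move=> mn.
  (* [D] counts the events from [m] to [n], and [q (n - m)] is subtracted from it; both lie between
     0 and [n - m]. *)
  have [D DE /andP[D0 D1]] : exists2 D, S n x = S m x + D & 0 <= D <= (n - m)%N%:R.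
    exists (\sum_(m <= i < n) \1_(E i) x).
      by rewrite /S -!(big_mkord xpredT (fun i => \1_(E i) x)) -big_cat_nat.
    rewrite sumr_ge0 => [|i _]; last by rewrite indicE.
    rewrite -[leRHS]sumr_const_nat; apply: ler_sum => i _.
    by rewrite indicE lern1 leq_b1.
  have nmE : (n - m)%N%:R = n%:R - m%:R :> R by rewrite natrB.
  rewrite ler_norml /u DE nmE; rewrite nmE in D1.
  have nm0 : 0 <= n%:R - m%:R :> R by rewrite -nmE.
  have := mulr_ge0 nm0 q_ge0; have := ler_piMr nm0 q_le1.
  by move=> h1 h2; apply/andP; split; lra.
have u_cvg : (fun m => u (m.+1 ^ 2)%N / (m.+1 ^ 2)%N%:R) @ \oo --> (0 : R).
  apply/cvgrPdist_le => e e0.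
  (* [g m x] is the square of the quotient to be bounded, hence the threshold [e ^+ 2]. *)
  have e20 : 0 < e ^+ 2 by rewrite exprn_gt0.
  have [N _ NP] := (cvgrPdist_le _ _).1 g_cvg _ e20.
  exists N => // m /= Nm; have := NP m Nm; rewrite !sub0r !normrN (ger0_norm (g0 _ _)).
  move=> gm; rewrite -ler_sqr ?nnegrE ?normr_ge0 ?(ltW e0) //.
  by rewrite real_normK ?num_real.
have := lipschitz_cvg_squares u_lip u_cvg.
move=> /(cvgD (cvg_cst q)); rewrite addr0; apply: cvg_trans.
apply: near_eq_cvg; near=> n.
have n0 : n%:R != 0 :> R by rewrite pnatr_eq0 -lt0n; near: n; exists 1%N.
rewrite -[LHS]/(q + u n / n%:R) /u mulrBl mulrAC divff // mul1r.
by rewrite addrC subrK.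
Unshelve. all: by end_near.
Qed.

End SLLN.

Theorem theorem12 (R : realType) (p : nat) (p_pr : prime p) (p_odd : odd p)
    (mu : {measure set (borel_padic p_pr) -> \bar R})
    (mu_haar : normalized_haar mu)
    (y : rat) (k : int) (yT : calT p y) (yk : padic_val p y = (- k)%:E) :
  {ae mu, forall alpha : padic p_pr, pZp p_pr alpha ->
    odd_frequency R alpha y @ \oo --> (p%:R ^ (- 2 * k + 1) : R)}.
Proof.
(* The finite valuation excludes [y = 0], whose valuation is [+oo]. *)
have y0 : y != 0 by apply: contra_eq_neq yk => ->; rewrite /padic_val eqxx.
have [yZ /andP[y1 y2]] := yT.
have y_floor : is_floor 0 (ratr y : padic p_pr) y.
  split=> //; first by rewrite expr0 ltr_norml -mulNr y1 y2.
  by rewrite subrr; exact: pideal0.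
have yv : pval (ratr y : padic p_pr) (- k) by exact: pval_ratr.
(* A nonzero value of [t] is not in [Z_p], so [k] is positive; [j] is the shifted exponent used for
   the digit events. *)
have [j kE] : exists j : nat, k = j.+1%:Z.
  suff : 0 < k by exists `|k|%N.-1; lia.
  rewrite ltNge; apply/negP => k0; have := is_floor_neq0 y0 y_floor; apply.
  by apply: pideal_le (pval_pideal yv); rewrite oppr_ge0.
rewrite kE in yv *.
pose E := digit_event (p_pr := p_pr) y.
have uE n : uniform mu (E n) by exact: (uniform_digit_event mu_haar p_odd).
have := @pairwise_independent_frequency _ _ _ mu (pZp p_pr) E
  (p%:R^-1 ^+ (2 * j).+1) (uniform_measurable (uniform_pZp mu_haar)) (haar_pZp mu_haar)
  (fun n => uniform_measurable (uE n)) (fun n => (uE n).1)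
  (haar_digit_event mu_haar p_odd y_floor yv)
  (haar_digit_eventI mu_haar p_odd y_floor yv).
have := ae_domain mu_haar p_odd.
apply: (@filterS2 _ _ (ae_filter_ringOfSetsType mu)) => x xD xE xX.
have -> : p%:R ^ (- 2 * j.+1%:Z + 1) = p%:R^-1 ^+ (2 * j).+1 :> R.
  by rewrite exprVn exprnP invr_expz; congr (_ ^ _); lia.
have -> : odd_frequency R x y = fun n => (\sum_(i < n) \1_(E i) x) / n%:R.
  apply/funext => n; apply: (odd_frequencyE mu_haar p_odd); exact: xD.
exact: xE.
Qed.
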